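(* The number $V_n$ of virtual $n$-crossings up to rotation satisfies $$V_n \sim \frac{n!\, e^{2\sqrt{n}}}{2\sqrt{\pi e}\; n^{7/4}},$$ in the sense that the ratio between the two sides converges to $1$ as $n \to \infty$.
   Context: A virtual $n$-crossing consists of $n$ unoriented straight strands $\alpha_1,\dots,\alpha_n$, labeled in clockwise order, through a common point in the plane. Each pair of distinct strands crosses either classically or virtually, subject to the validity condition that no three strands have exactly one virtual pair and two classical pairs among their three pairs; equivalently, the relation ''$\alpha_i = \alpha_j$ or $\alpha_i,\alpha_j$ cross classically'' is an equivalence relation on $\{\alpha_1,\dots,\alpha_n\}$. The strands pass through the crossing at distinct heights, but heights matter only for determining which strand is over in each classically crossing pair. Thus a labeled virtual $n$-crossing is the same as a partition of $\{\alpha_1,\dots,\alpha_n\}$ into nonempty parts together with a linear order (by height) on each part; the parts themselves are not ordered. Two labeled virtual $n$-crossings are the same up to rotation if one is obtained from the other by a cyclic shift of labels $\alpha_i \mapsto \alpha_{i+r}$ (indices modulo $n$). $V_n$ denotes the number of equivalence classes of labeled virtual $n$-crossings under rotation. *)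

(* Defs.v *)
From mathcomp Require Import all_boot.

Set Implicit Arguments.
Unset Strict Implicit.
Unset Printing Implicit Defensive.

(* The strands alpha_1, ..., alpha_n are the elements 0, ..., n-1 of 'I_n.
   In a labeled crossing x, the component x.1 is the partition of the strands
   into parts (two distinct strands cross classically iff they lie in the same
   part), and (i, j) \in x.2 means that i and j cross classically with i above
   j. *)
Definition crossing_data (n : nat) : finType :=
  ({set {set 'I_n}} * {set 'I_n * 'I_n})%type.

Definition same_part n (P : {set {set 'I_n}}) (i j : 'I_n) : bool :=
  [exists B in P, (i \in B) && (j \in B)].

(* When P is a partition, the restriction of O to each part of P is a strict
   linear order, and O relates no two strands of different parts. *)
Definition linear_on_parts n (P : {set {set 'I_n}}) (O : {set 'I_n * 'I_n}) :
    bool :=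
  [&& [forall i, forall j, ((i, j) \in O) ==> same_part P i j],
      [forall i, (i, i) \notin O],
      [forall i, forall j, forall k,
         ((i, j) \in O) && ((j, k) \in O) ==> ((i, k) \in O)]
    & [forall i, forall j, same_part P i j && (i != j) ==>
         ((i, j) \in O) || ((j, i) \in O)]].

(* mathcomp's [partition] also requires the parts to be nonempty. *)
Definition vcrossings (n : nat) : {set crossing_data n} :=
  [set x : crossing_data n |
     partition x.1 [set: 'I_n] && linear_on_parts x.1 x.2].

(* i |-> i + r modulo n, since [ordS] is the cyclic successor on 'I_n *)
Definition shift_strand n (r : nat) (i : 'I_n) : 'I_n := iter r (@ordS n) i.

Definition rotate_crossing n (r : nat) (x : crossing_data n) :
    crossing_data n :=
  ([set [set shift_strand r i | i in B] | B : {set 'I_n} in x.1],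
   [set (shift_strand r p.1, shift_strand r p.2) | p in x.2]).

Definition same_up_to_rotation n (x y : crossing_data n) : bool :=
  [exists r : 'I_n, y == rotate_crossing r x].

(* V n is the number V_n of virtual n-crossings up to rotation. *)
Definition V (n : nat) : nat :=
  #|equivalence_partition (@same_up_to_rotation n) (vcrossings n)|.

(* Main.v *)
Require Import Defs.
From mathcomp Require Import all_boot all_order all_algebra all_fingroup.

(* A colouring of the parts by x colours, together with the crossing, is the
   same as a permutation of the strands and a weakly increasing word in x
   letters; hence sum_k f(n,k) x^_k = n! C(n+x-1, n), and Vandermonde gives
   n! C(n-1, k-1) / k! labeled crossings with k parts.  A rotation r != 0 acts
   freely on the strands, so a crossing it fixes is determined by its values on
   at most n/2 strands; there are so few of those that V_n is asymptotically
   the number of labeled crossings divided by n.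

   For the sum over k = j + 1, put s = sqrt n and write C(n-1, j) / (j+1)! as
   (2s)^(2j+1) / (2j+1)! * (C(2j+2, j+1) / 4^(j+1)) * prod_(i<=j) (1 - i/n) / s.
   The first factors sum to sinh (2s) and, as weights, have j concentrated at s
   by Chebyshev's inequality, with relative variance O(1/s); there the second
   factor is (pi s)^(-1/2) by Wallis' product and the third is e^(-1/2). *)

Set Implicit Arguments.
Unset Strict Implicit.
Unset Printing Implicit Defensive.

(** * Counting labeled crossings *)

Lemma same_part_preim n (T : eqType) (c : 'I_n -> T) (i j : 'I_n) :
  same_part (preim_partition c [set: 'I_n]) i j = (c i == c j).
Proof.
apply/existsP/idP => [[B /andP[/imsetP[k _ ->]]]|cij].
  by rewrite !inE => /andP[/eqP <- /eqP <-].
exists [set k in [set: 'I_n] | c i == c k].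
by rewrite (imset_f (fun i => [set k in _ | c i == c k])) ?inE //= eqxx.
Qed.

Lemma linear_on_partsP n (P : {set {set 'I_n}}) (O : {set 'I_n * 'I_n}) :
  reflect [/\ forall i j, (i, j) \in O -> same_part P i j,
              forall i, (i, i) \notin O,
              forall i j k, (i, j) \in O -> (j, k) \in O -> (i, k) \in O &
              forall i j, same_part P i j -> i != j ->
                ((i, j) \in O) || ((j, i) \in O)]
          (linear_on_parts P O).
Proof.
apply: (iffP and4P) => [[h1 h2 h3 h4]|[h1 h2 h3 h4]]; split.
- by move=> i j; move/forallP/(_ i)/forallP/(_ j)/implyP: h1.
- exact/forallP.
- move=> i j k ij jk.
  move/forallP/(_ i)/forallP/(_ j)/forallP/(_ k)/implyP: h3; apply.
  by rewrite ij.
- move=> i j ij nij; move/forallP/(_ i)/forallP/(_ j)/implyP: h4; apply.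
  by rewrite ij.
- by apply/forallP => i; apply/forallP => j; apply/implyP/h1.
- exact/forallP.
- apply/forallP => i; apply/forallP => j; apply/forallP => k.
  by apply/implyP => /andP[]; apply: h3.
- by apply/forallP => i; apply/forallP => j; apply/implyP => /andP[]; apply: h4.
Qed.

(** The permutation sends i to its rank, the number of elements below i. Ranks increase strictly
    along [lt], so totality makes the rank map injective. *)
Lemma total_order_rank n (lt : rel 'I_n) :
    irreflexive lt -> transitive lt ->
    (forall i j, i != j -> lt i j || lt j i) ->
  exists s : 'S_n, forall i j, (s i < s j) = lt i j.
Proof.
move=> ltxx lt_tr lt_tot.
have rank_lt i : #|[set k | lt k i]| < n.
  rewrite -[X in _ < X]card_ord -cardsT; apply: proper_card.
  rewrite properE subsetT; apply/subsetPn; exists i; first by rewrite inE.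
  by rewrite inE ltxx.
pose rk i := Ordinal (rank_lt i).
have rk_mono i j : lt i j -> rk i < rk j.
  move=> ij; apply: proper_card; rewrite properE; apply/andP; split.
    by apply/subsetP => k; rewrite !inE => ki; apply: lt_tr ij.
  by apply/subsetPn; exists i; rewrite inE ?ij // ltxx.
have rkE i j : (rk i < rk j) = lt i j.
  apply/idP/idP; last exact: rk_mono.
  have [->|nij] := eqVneq i j; first by rewrite ltnn.
  case/orP: (lt_tot _ _ nij) => // /rk_mono ji ij.
  by move: (ltn_trans ij ji); rewrite ltnn.
have rk_inj : injective rk.
  move=> i j rij; apply/eqP; apply: contraT => nij.
  by case/orP: (lt_tot _ _ nij); rewrite -rkE rij ltnn.
by exists (perm rk_inj) => i j; rewrite !permE.
Qed.

(** The value s i is the number of k with s k < s i, so it can be read off from the induced order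
    alone. *)
Lemma perm_eq_order n (s t : 'S_n) :
  (forall i j, (s i < s j) = (t i < t j)) -> s = t.
Proof.
move=> st; apply/permP => i; apply: val_inj.
have rkE (u : 'S_n) : val (u i) = #|[set k | u k < u i]|.
  transitivity #|[set m : 'I_n | m < u i]|.
    by rewrite -sum1dep_card big_ord_narrow ?sum1_card ?card_ord // ltnW.
  rewrite -(card_imset [set k | u k < u i] (@perm_inj _ u)).
  congr #|pred_of_set _|; apply/setP => m; rewrite inE.
  apply/idP/imsetP => [mi|[k]]; last by rewrite inE => ? ->.
  by exists ((u^-1)%g m); rewrite ?inE permKV.
rewrite [LHS]rkE [RHS]rkE; congr #|pred_of_set _|; apply/setP => k.
by rewrite !inE st.
Qed.

(* y.1 is a colouring whose colour classes are the parts of the crossing. *)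
Definition colored_orders n x : {set {ffun 'I_n -> 'I_x} * {set 'I_n * 'I_n}} :=
  [set y : {ffun 'I_n -> 'I_x} * {set 'I_n * 'I_n} |
     linear_on_parts (preim_partition y.1 [set: 'I_n]) y.2].

Lemma sorted_tuple_homo n x (t : n.-tuple 'I_x) :
  reflect (forall i j : 'I_n, i < j -> tnth t i <= tnth t j)
          (sorted leq (map val t)).
Proof.
case: n t => [|n] t; first by rewrite tuple0; apply: ReflectT; case.
have tE (i : 'I_n.+1) : nth 0 (map val t) i = tnth t i.
  by rewrite (nth_map (tnth t i)) ?size_tuple // -tnth_nth.
rewrite (sorted_pairwise leq_trans).
apply: (iffP (pairwiseP 0)) => [h i j ij|h i j].
  by rewrite -!tE h // inE size_map size_tuple.
rewrite !inE size_map size_tuple => ilt jlt ij.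
by have := h (Ordinal ilt) (Ordinal jlt) ij; rewrite -!tE.
Qed.

(* Listing the strands colour by colour, and within a colour by height, is a
   bijection from coloured orders to pairs of a permutation and a weakly
   increasing word of colours. *)
Lemma card_colored_orders n x : #|colored_orders n x.+1| = n`! * 'C(n + x, n).
Proof.
pose col (st : 'S_n * n.-tuple 'I_x.+1) := [ffun i => tnth st.2 (st.1 i)].
pose f st := (col st, [set p : 'I_n * 'I_n |
                 (col st p.1 == col st p.2) && (st.1 p.1 < st.1 p.2)]).
pose S := [set t : n.-tuple 'I_x.+1 | sorted leq (map val t)].
(* [lex] compares strands by colour, then by height within a colour. By [lexE] it is the order
   induced by the permutation, so the image under [f] determines the permutation. *)
pose lex (y : {ffun 'I_n -> 'I_x.+1} * {set 'I_n * 'I_n}) (i j : 'I_n) :=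
  (y.1 i < y.1 j) || ((i, j) \in y.2).
have lexE st i j : st.2 \in S -> lex (f st) i j = (st.1 i < st.1 j).
  case: st => s t /=; rewrite inE => /sorted_tuple_homo t_homo.
  rewrite /lex /= !inE !ffunE /=.
  case: (ltngtP (s i) (s j)) => [ij|ij|/val_inj ->].
  - by rewrite andbT orbC -leq_eqVlt t_homo.
  - by rewrite andbF orbF ltnNge t_homo.
  - by rewrite ltnn andbF.
have f_inj : {in setX setT S &, injective f}.
  move=> [s t] [s' t']; rewrite !inE /= => tS tS' ff.
  have ss : s = s'.
    apply: perm_eq_order => i j.
    by rewrite -(lexE (s, t)) ?inE // ff lexE ?inE.
  rewrite -{}ss in ff *; congr pair; apply: eq_from_tnth => i.
  case: ff => /ffunP/(_ ((s^-1)%g i)) + _.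
  by rewrite !ffunE /= permKV.
have -> : colored_orders n x.+1 = f @: setX setT S.
  apply/setP => -[c O]; rewrite inE; apply/linear_on_partsP/imsetP.
    rewrite /=; move=> [O_part O_irr O_tr O_tot].
    have Oc i j : (i, j) \in O -> c i = c j.
      by move/O_part; rewrite same_part_preim => /eqP.
    have [s sE] : exists s : 'S_n, forall i j, (s i < s j) = lex (c, O) i j.
      apply: total_order_rank => [i|j i k|i j ij]; rewrite /lex /=.
      - by rewrite ltnn (negbTE (O_irr i)).
      - case/orP=> [cij|ij] /orP[cjk|jk].
        + by rewrite (ltn_trans cij cjk).
        + by rewrite -(Oc _ _ jk) cij.
        + by rewrite (Oc _ _ ij) cjk.
        + by rewrite (O_tr _ _ _ ij jk) orbT.
      - case: (ltngtP (c i) (c j)) => [//|_|/val_inj cij] /=.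
          by rewrite orbT.
        by apply: O_tot ij; rewrite same_part_preim cij.
    (* The word of colours met along [s]; it increases weakly because [lex] compares colours
       first. *)
    pose t := [tuple c ((s^-1)%g i) | i < n].
    have colE : col (s, t) = c.
      by apply/ffunP => i; rewrite ffunE tnth_mktuple permK.
    exists (s, t).
      rewrite !inE; apply/sorted_tuple_homo => i j ij; rewrite !tnth_mktuple.
      have := sE ((s^-1)%g i) ((s^-1)%g j); rewrite !permKV ij => /esym/orP[].
        exact: ltnW.
      by move/Oc ->.
    rewrite /f colE; congr pair; apply/setP => -[i j]; rewrite inE /= sE /lex /=.
    apply/idP/andP => [ij|[/eqP ->]]; last by rewrite ltnn.
    by rewrite (Oc _ _ ij) ij orbT.
  case=> -[s t] _ [-> ->]; split=> /= [i j|i|i j k|i j].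
  - by rewrite inE same_part_preim => /andP[].
  - by rewrite inE ltnn andbF.
  - rewrite !inE => /andP[/eqP -> ij] /andP[-> jk].
    exact: ltn_trans jk.
  - rewrite same_part_preim !inE /= => /eqP -> nij; rewrite eqxx /= -neq_ltn.
    by rewrite (inj_eq val_inj) (inj_eq perm_inj).
by rewrite card_in_imset // cardsX cardsT card_Sn card_sorted_tuples.
Qed.

(** These colourings are exactly the injections from the blocks into the colours, composed with the
    map that sends a point to its block. *)
Lemma card_colorings_partition (T : finType) (P : {set {set T}}) x :
    partition P [set: T] ->
  #|[set c : {ffun T -> 'I_x} | preim_partition c [set: T] == P]| = x ^_ #|P|.
Proof.
move=> partP; have [/eqP covP tiP P0] := and3P partP.
have blockP i : pblock P i \in P by rewrite pblock_mem // covP.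
pose blk i : {B | B \in P} := exist _ (pblock P i) (blockP i).
pose f (g : {ffun {B | B \in P} -> 'I_x}) := [ffun i => g (blk i)].
have blk_surj B : exists i, blk i == B.
  case: B => B BP.
  have [i iB] : exists i, i \in B.
    by apply/set0Pn; apply: contraNneq P0 => <-.
  by exists i; apply/eqP/val_inj/def_pblock.
have blkE i j : (blk i == blk j) = (j \in pblock P i).
  by rewrite -val_eqE /= eq_pblock ?covP.
have f_inj : injective f.
  move=> g h /ffunP gh; apply/ffunP => B; have [i /eqP <-] := blk_surj B.
  by have := gh i; rewrite !ffunE.
have <- : #|{: {B | B \in P}}| = #|P| by rewrite card_sig.
rewrite -[x in RHS]card_ord -card_inj_ffuns -(card_imset _ f_inj).
congr #|pred_of_set _|; apply/setP => c; rewrite inE; apply/eqP/imsetP.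
  move=> cP.
  have cE i j : (c i == c j) = (j \in pblock P i).
    rewrite -cP (pblock_equivalence_partition (R := fun i j => c i == c j)) //.
    by split=> // /eqP ->.
  pose rep (B : {B | B \in P}) : T := xchoose (blk_surj B).
  have repK B : blk (rep B) = B by apply/eqP/(xchooseP (blk_surj B)).
  exists [ffun B => c (rep B)].
    rewrite inE; apply/injectiveP => B B'; rewrite !ffunE => cBB'.
    apply/eqP; rewrite -[B]repK -[B']repK blkE -cE.
    exact/eqP.
  by apply/ffunP => i; rewrite !ffunE; apply/eqP; rewrite cE -(blkE i) repK.
case=> g; rewrite inE => /injectiveP g_inj ->.
rewrite -[RHS](equivalence_partition_pblock partP).
apply: eq_in_imset => i _; apply/setP => j; rewrite !inE !ffunE.
by rewrite (inj_eq g_inj) blkE.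
Qed.

(** Coloured orders are grouped by the crossing left after forgetting colours; each group is a set
    of colourings with prescribed colour classes. *)
Lemma colored_orders_vcrossings n x :
  #|colored_orders n x| = \sum_(y in vcrossings n) x ^_ #|y.1|.
Proof.
pose h (y : {ffun 'I_n -> 'I_x} * {set 'I_n * 'I_n}) : crossing_data n :=
  (preim_partition y.1 [set: 'I_n], y.2).
rewrite -sum1_card (partition_big h (mem (vcrossings n))) /=; last first.
  by move=> y; rewrite !inE preim_partitionP.
apply: eq_bigr => -[P O]; rewrite inE /= => /andP[partP linO].
rewrite -card_colorings_partition // sum1dep_card.
have pair_inj : injective (fun c : {ffun 'I_n -> 'I_x} => (c, O)).
  by move=> ? ? [].
rewrite -[RHS](card_imset _ pair_inj).
congr #|pred_of_set _|; apply/setP => -[c O']; rewrite !inE /h /= xpair_eqE.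
apply/and3P/imsetP => [[_ cP /eqP ->]|[d]]; first by exists c; rewrite ?inE.
by rewrite inE => /eqP dP [-> ->]; rewrite dP !eqxx.
Qed.

(** The system is triangular: at x = k the binomials with index above k vanish, and the one with
    index k equals 1. *)
Lemma binomial_basis_inj (N : nat) (u v : nat -> nat) :
    (forall x, \sum_(k < N) u k * 'C(x, k) = \sum_(k < N) v k * 'C(x, k)) ->
  forall k, k < N -> u k = v k.
Proof.
move=> uv; elim/ltn_ind => k IHk kN.
have split (w : nat -> nat) : \sum_(j < N) w j * 'C(k, j) = \sum_(j < k) w j * 'C(k, j) + w k.
  rewrite -(big_mkord xpredT (fun j => w j * 'C(k, j))) /=.
  rewrite (big_cat_nat (leq0n k) (ltnW kN)) /= big_mkord; congr (_ + _).
  rewrite big_ltn // binn muln1 big_nat_cond big1 ?addn0 // => j.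
  by case/andP=> /andP[kj _] _; rewrite bin_small ?muln0.
have := uv k; rewrite !split => /eqP.
rewrite (eq_bigr (fun j : 'I_k => v j * 'C(k, j))).
  by rewrite eqn_add2l => /eqP.
by move=> j _; rewrite IHk // (ltn_trans _ kN).
Qed.

Lemma card_partition_le (T : finType) (P : {set {set T}}) :
  partition P [set: T] -> #|P| <= #|T|.
Proof.
move=> partP; have [_ _ P0] := and3P partP.
rewrite -cardsT (card_partition partP) -sum1_card; apply: leq_sum => B BP.
by rewrite card_gt0; apply: contraNneq P0 => <-.
Qed.

(** Both sides are coefficients of the number of coloured orders, as a function of the number x of
    colours, in the basis of binomials C(x, k). One expansion comes from grouping by crossing, the
    other from Vandermonde's identity. *)
Lemma card_vcrossings_parts n k : k <= n.+1 ->
  #|[set y in vcrossings n.+1 | #|y.1| == k]| * k`! = n.+1`! * 'C(n, n.+1 - k).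
Proof.
move=> kn.
pose u k := #|[set y in vcrossings n.+1 | #|y.1| == k]| * k`!.
apply: (@binomial_basis_inj n.+2 u (fun k => n.+1`! * 'C(n, n.+1 - k))) => // x.
transitivity #|colored_orders n.+1 x|.
  rewrite colored_orders_vcrossings.
  (* [inord] loses nothing here, since there are at most as many parts as strands. *)
  rewrite (partition_big (fun y : crossing_data n.+1 => inord #|y.1|)
             (fun k : 'I_n.+2 => true)) //=.
  apply: eq_bigr => j _; rewrite /u -mulnA [j`! * _]mulnC bin_ffact.
  rewrite -sum1dep_card big_distrl /=.
  have le_card (y : crossing_data n.+1) :
      y \in vcrossings n.+1 -> #|y.1| < n.+2.
    by rewrite inE => /andP[/card_partition_le]; rewrite card_ord.
  apply: eq_big => [y|y /andP[_ /eqP ->]]; last by rewrite mul1n.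
  apply: andb_id2l => /le_card yn.
  by rewrite -val_eqE /= inordK.
transitivity (n.+1`! * 'C(x + n, n.+1)).
  (* Without colours, a nonempty set of strands has no colouring, and C(n, n+1) = 0. *)
  case: x => [|x]; last by rewrite card_colored_orders addSnnS addnC.
  rewrite add0n bin_small // muln0; apply/eqP; rewrite cards_eq0 -subset0.
  by apply/subsetP => -[c O]; case: (c ord0).
rewrite -binomial.Vandermonde big_distrr /=; apply: eq_bigr => j _.
by rewrite [in RHS]mulnAC mulnA.
Qed.

Lemma card_vcrossings_sum n :
  #|vcrossings n| = \sum_(k < n.+1) #|[set y in vcrossings n | #|y.1| == k]|.
Proof.
rewrite -sum1_card (partition_big (fun y : crossing_data n => inord #|y.1|)
             (fun k : 'I_n.+1 => true)) //=.
apply: eq_bigr => j _; rewrite -sum1dep_card; apply: eq_bigl => y.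
apply: andb_id2l; rewrite inE => /andP[/card_partition_le + _].
by rewrite card_ord => yn; rewrite -val_eqE /= inordK.
Qed.

(** * Rotations *)

Lemma val_shift_strand n r (i : 'I_n) : val (shift_strand r i) = (i + r) %% n.
Proof.
rewrite /shift_strand; elim: r => [|r IHr] /=; first by rewrite addn0 modn_small.
by rewrite IHr -addn1 modnDml addn1 addnS.
Qed.

Lemma shift_strand_inj n r : injective (@shift_strand n r).
Proof.
rewrite /shift_strand; elim: r => [|r IHr] i j //=.
by move/(@ordS_inj n)/IHr.
Qed.

Lemma shift_strand_surj n r (j : 'I_n) : exists i, j = shift_strand r i.
Proof.
have [g _ gK] := injF_bij (@shift_strand_inj n r).
by exists (g j); rewrite gK.
Qed.

Lemma shift_strandD n r s (i : 'I_n) :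
  shift_strand r (shift_strand s i) = shift_strand (r + s) i.
Proof. by rewrite /shift_strand iterD. Qed.

Lemma shift_strand_mod n r s :
  r = s %[mod n] -> @shift_strand n r =1 @shift_strand n s.
Proof.
move=> rs i; apply: val_inj.
by rewrite !val_shift_strand -modnDmr rs modnDmr.
Qed.

Lemma mem_rotate_order n r (x : crossing_data n) i j :
  ((shift_strand r i, shift_strand r j) \in (rotate_crossing r x).2)
    = ((i, j) \in x.2).
Proof.
apply/imsetP/idP => [[[k l] /= kl [/shift_strand_inj -> /shift_strand_inj ->]]|] //.
by move=> ij; exists (i, j).
Qed.

Lemma same_part_rotate n r (x : crossing_data n) i j :
  same_part (rotate_crossing r x).1 (shift_strand r i) (shift_strand r j)
    = same_part x.1 i j.
Proof.
apply/existsP/existsP => [[_ /andP[/imsetP[B BP ->]]]|[B /andP[BP ij]]].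
  by rewrite !(mem_imset _ _ (@shift_strand_inj n r)) => ij; exists B; rewrite BP.
exists [set shift_strand r k | k in B].
rewrite !(mem_imset _ _ (@shift_strand_inj n r)) ij andbT.
by apply/imsetP; exists B.
Qed.

Lemma rotate_crossingD n r s (x : crossing_data n) :
  rotate_crossing r (rotate_crossing s x) = rotate_crossing (r + s) x.
Proof.
case: x => P O; rewrite /rotate_crossing /= -!imset_comp; congr pair.
  apply: eq_imset => B /=; rewrite -imset_comp.
  by apply: eq_imset => i /=; rewrite shift_strandD.
by apply: eq_imset => -[i j]; rewrite /= !shift_strandD.
Qed.

Lemma rotate_crossing_mod n r s (x : crossing_data n) :
  r = s %[mod n] -> rotate_crossing r x = rotate_crossing s x.
Proof.
move=> /shift_strand_mod rs; rewrite /rotate_crossing; congr pair.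
  by apply: eq_imset => B; apply: eq_imset.
by apply: eq_imset => p; rewrite !rs.
Qed.

Lemma rotate_crossing0 n (x : crossing_data n) : rotate_crossing 0 x = x.
Proof.
case: x => P O; rewrite /rotate_crossing /=; congr pair.
  rewrite -[RHS]imset_id; apply: eq_imset => B; exact: imset_id.
by rewrite -[RHS]imset_id; apply: eq_imset => -[].
Qed.

Lemma rotate_vcrossings n r (x : crossing_data n) :
  x \in vcrossings n -> rotate_crossing r x \in vcrossings n.
Proof.
rewrite !inE => /andP[partP /linear_on_partsP[h1 h2 h3 h4]].
apply/andP; split.
  have <- : shift_strand r @: [set: 'I_n] = [set: 'I_n].
    apply/setP => j; have [i ->] := shift_strand_surj r j.
    by rewrite imset_f inE.
  by rewrite (imset_partition _ _ (@shift_strand_inj n r)).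
apply/linear_on_partsP; split=> [i j|i|i j k|i j];
  have [i' ->] := shift_strand_surj r i;
  rewrite ?mem_rotate_order //; have [j' ->] := shift_strand_surj r j;
  rewrite ?mem_rotate_order ?same_part_rotate.
- exact: h1.
- by have [k' ->] := shift_strand_surj r k; rewrite !mem_rotate_order; apply: h3.
- by rewrite (inj_eq (@shift_strand_inj n r)); apply: h4.
Qed.

Lemma same_up_to_rotationP n (x y : crossing_data n) :
  0 < n ->
  reflect (exists r, y = rotate_crossing r x) (same_up_to_rotation x y).
Proof.
move=> n_gt0; apply: (iffP existsP) => [[r /eqP ->]|[r ->]]; first by exists r.
exists (Ordinal (ltn_pmod r n_gt0)); apply/eqP.
by apply: rotate_crossing_mod; rewrite /= modn_mod.
Qed.

Lemma same_up_to_rotation_equiv n (D : {set crossing_data n}) :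
  0 < n -> {in D & &, equivalence_rel (@same_up_to_rotation n)}.
Proof.
move=> n_gt0 x y z _ _ _; split=> [|/(same_up_to_rotationP _ _ n_gt0)[r ->]].
  by apply/same_up_to_rotationP => //; exists 0; rewrite rotate_crossing0.
apply/same_up_to_rotationP/same_up_to_rotationP => // -[s ->].
  (* The witness is s - r modulo n, with r * n added so that the natural subtraction is not
     truncated. *)
  exists (s + (r * n - r)); rewrite rotate_crossingD; apply: rotate_crossing_mod.
  have rn : r <= r * n by rewrite leq_pmulr.
  by rewrite -addnA subnK // addnC modnMDl.
by exists (s + r); rewrite rotate_crossingD.
Qed.

Definition nonfree n : {set crossing_data n} :=
  [set x in vcrossings n | [exists r : 'I_n, (0 < r) && (rotate_crossing r x == x)]].

Lemma card_rotation_class_le n (x : crossing_data n) :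
  #|[set y in vcrossings n | same_up_to_rotation x y]| <= n.
Proof.
rewrite -[X in _ <= X]card_ord -cardsT.
apply: leq_trans (leq_imset_card (fun r : 'I_n => rotate_crossing r x) _).
apply/subset_leq_card/subsetP => y; rewrite inE => /andP[_ /existsP[r /eqP ->]].
by apply/imsetP; exists r; rewrite ?inE.
Qed.

(** If two of the n rotations of x agreed, the rotation by their difference would fix x. *)
Lemma card_rotation_class_free n (x : crossing_data n) :
    x \in vcrossings n -> x \notin nonfree n ->
  n <= #|[set y in vcrossings n | same_up_to_rotation x y]|.
Proof.
move=> xV; rewrite inE xV /= => /existsPn x_free.
rewrite -[X in X <= _]card_ord -cardsT.
have rot_lt (r s : 'I_n) : r < s -> rotate_crossing r x != rotate_crossing s x.
  move=> rs; apply/eqP => xrs.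
  have sr_lt : s - r < n by apply: leq_ltn_trans (leq_subr _ _) (ltn_ord s).
  have := x_free (Ordinal sr_lt); rewrite /= subn_gt0 rs /= => /eqP; apply.
  (* Rotating further by n - r turns [xrs] into invariance of x under s - r. *)
  have := congr1 (rotate_crossing (n - r)) xrs; rewrite !rotate_crossingD.
  rewrite subnK ?(ltnW (ltn_ord r)) // (@rotate_crossing_mod _ n 0) ?modnn ?mod0n //.
  rewrite rotate_crossing0 => {2}->; apply: rotate_crossing_mod.
  have -> : n - r + s = n + (s - r).
    by rewrite addnBA ?(ltnW rs) // addnBAC // ltnW.
  by rewrite modnDl.
have rot_inj : injective (fun r : 'I_n => rotate_crossing r x).
  move=> r s rs; apply: val_inj.
  by case: (ltngtP r s) => // /rot_lt; rewrite rs eqxx.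
rewrite -(card_imset _ rot_inj).
apply/subset_leq_card/subsetP => _ /imsetP[r _ ->].
by rewrite inE rotate_vcrossings //; apply/existsP; exists r.
Qed.

(** Classes have at most n members, which gives the lower bound. For the upper bound each crossing
    has weight 1, plus n if it is in [nonfree]. Every class then weighs at least n: its
    representative is in [nonfree] and weighs enough alone, or the class has n members. *)
Lemma V_bounds n : 0 < n ->
  #|vcrossings n| <= V n * n <= #|vcrossings n| + n * #|nonfree n|.
Proof.
move=> n_gt0.
have equivD := @same_up_to_rotation_equiv n (vcrossings n) n_gt0.
have partV := equivalence_partitionP equivD.
rewrite /V; apply/andP; split.
  rewrite (card_partition partV) -sum_nat_const; apply: leq_sum => B.
  by case/imsetP=> x _ ->; apply: card_rotation_class_le.
have -> : #|vcrossings n| + n * #|nonfree n|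
    = \sum_(x in vcrossings n) (1 + n * (x \in nonfree n)).
  rewrite big_split /= sum1_card -big_distrr /=; congr (_ + n * _).
  rewrite -sum1_card [RHS]big_mkcond /= [LHS]big_mkcond /=.
  by apply: eq_bigr => x _; case: (boolP (x \in nonfree n)) => [/setIdP[-> _]|_] //; case: ifP.
rewrite (set_partition_big _ partV) /= -sum_nat_const.
apply: leq_sum => B /imsetP[x xV ->].
have xB : x \in [set y in vcrossings n | same_up_to_rotation x y].
  rewrite inE xV; apply/(same_up_to_rotationP _ _ n_gt0).
  by exists 0; rewrite rotate_crossing0.
have [xF|xF] := boolP (x \in nonfree n).
  by rewrite (bigD1 x) //= xF muln1 addnAC leq_addl.
apply: leq_trans (card_rotation_class_free xV xF) _.
by rewrite -sum1_card; apply: leq_sum => y _; rewrite leq_addr.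
Qed.

(** The covering relation: j lies directly below i. It is a partial function of i that determines
    the whole order, hence a compact code for a crossing. *)
Definition covers n (O : {set 'I_n * 'I_n}) (i j : 'I_n) :=
  ((i, j) \in O) && [forall k, ~~ (((i, k) \in O) && ((k, j) \in O))].

(** Both candidates lie in the part of i, so they are comparable, and the upper one would sit
    between i and the lower one. *)
Lemma covers_unique n P (O : {set 'I_n * 'I_n}) i j j' :
  linear_on_parts P O -> partition P [set: 'I_n] ->
  covers O i j -> covers O i j' -> j = j'.
Proof.
move=> /linear_on_partsP[Op _ _ Ot] partP /andP[ij /forallP cij] /andP[ij' /forallP cij'].
apply/eqP; apply: contraT => jj'.
have jPj' : same_part P j j'.
  have /existsP[B /and3P[BP iB jB]] := Op _ _ ij.
  have /existsP[B' /and3P[BP' iB' jB']] := Op _ _ ij'.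
  have [_ tiP _] := and3P partP.
  apply/existsP; exists B; rewrite BP jB /=.
  by rewrite -(def_pblock tiP BP iB) (def_pblock tiP BP' iB').
case/orP: (Ot _ _ jPj' jj') => [h|h].
  by have := cij' j; rewrite ij h.
by have := cij j'; rewrite ij' h.
Qed.

(** A finite order is the transitive closure of its covering relation, by induction on the number of
    strands strictly between i and j. *)
Lemma covers_sub n P P' (O O' : {set 'I_n * 'I_n}) :
    linear_on_parts P O -> linear_on_parts P' O' ->
  (forall i j, covers O i j -> covers O' i j) -> O \subset O'.
Proof.
move=> /linear_on_partsP[_ Oi Ot _] /linear_on_partsP[_ _ Ot' _] cOO'.
pose btw i j := [set k | ((i, k) \in O) && ((k, j) \in O)].
apply/subsetP => -[i j]; have [m] := ubnP #|btw i j|.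
elim: m i j => // m IHm i j ltm ij.
have [cij|] := boolP (covers O i j); first by case/andP: (cOO' _ _ cij).
rewrite /covers ij => /forallPn[k /negPn /andP[ik kj]].
have kb : k \in btw i j by rewrite inE ik.
have lt_ik : #|btw i k| < #|btw i j|.
  apply: proper_card; rewrite properE; apply/andP; split.
    by apply/subsetP => l; rewrite !inE => /andP[-> lk]; rewrite (Ot _ _ _ lk kj).
  by apply/subsetPn; exists k; rewrite // inE (negbTE (Oi k)) andbF.
have lt_kj : #|btw k j| < #|btw i j|.
  apply: proper_card; rewrite properE; apply/andP; split.
    by apply/subsetP => l; rewrite !inE => /andP[kl ->]; rewrite (Ot _ _ _ ik kl).
  by apply/subsetPn; exists k; rewrite // inE (negbTE (Oi k)).
rewrite ltnS in ltm; apply: (Ot' _ k); [apply: IHm ik|apply: IHm kj].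
  exact: leq_trans lt_ik ltm.
exact: leq_trans lt_kj ltm.
Qed.

(** The order already determines the partition: two strands share a part iff they are equal or
    comparable. *)
Lemma vcrossing_order_inj n :
  {in vcrossings n &, injective (fun x : crossing_data n => x.2)}.
Proof.
move=> [P O] [P' O']; rewrite !inE /= => /andP[partP linO] /andP[partP' linO'] OO'.
rewrite {}OO' in linO *; congr pair.
have spE Q (i j : 'I_n) : partition Q [set: 'I_n] -> linear_on_parts Q O' ->
    (j \in pblock Q i) = [|| i == j, (i, j) \in O' | (j, i) \in O'].
  move=> partQ linQ.
  have -> : (j \in pblock Q i) = same_part Q i j.
    have [/eqP covQ tiQ Q0] := and3P partQ.
    apply/idP/existsP => [ij|[B /and3P[BQ iB jB]]].
      by exists (pblock Q i); rewrite ij mem_pblock covQ inE pblock_mem // covQ inE.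
    by rewrite (def_pblock tiQ BQ iB).
  have [Op Oi Ot Ott] := linear_on_partsP _ _ linQ.
  apply/idP/or3P => [ij|[/eqP <-|/Op //|/Op]].
  - have [->|nij] := eqVneq i j; first exact: Or31.
    by case/orP: (Ott _ _ ij nij); [apply: Or32|apply: Or33].
  - have /bigcupP[B BQ iB] : i \in cover Q by rewrite (cover_partition partQ) inE.
    by apply/existsP; exists B; rewrite BQ iB.
  - by case/existsP=> B /and3P[BQ iB jB]; apply/existsP; exists B; rewrite BQ iB jB.
rewrite -(equivalence_partition_pblock partP).
rewrite -(equivalence_partition_pblock partP').
by apply: eq_in_imset => i _; apply/setP => j; rewrite !inE !spE.
Qed.

Lemma covers_rotate n r (x : crossing_data n) i j :
  covers (rotate_crossing r x).2 (shift_strand r i) (shift_strand r j)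
    = covers x.2 i j.
Proof.
rewrite /covers mem_rotate_order; congr (_ && _).
apply/forallP/forallP => [h k|h k].
  by have := h (shift_strand r k); rewrite !mem_rotate_order.
by have [k' ->] := shift_strand_surj r k; rewrite !mem_rotate_order.
Qed.

Lemma rotate_crossingM n r a (x : crossing_data n) :
  rotate_crossing r x = x -> rotate_crossing (a * r) x = x.
Proof.
move=> xr; elim: a => [|a IHa]; first by rewrite mul0n rotate_crossing0.
by rewrite mulSn -rotate_crossingD IHa.
Qed.

(** By Bézout's identity gcd(r, n) is a multiple of r modulo n, so multiples of r carry the residue
    of i modulo the gcd to i. *)
Lemma orbit_representative n r (i : 'I_n) : 0 < r ->
  exists a (i0 : 'I_n), i0 < gcdn r n /\ i = shift_strand (a * r) i0.
Proof.
move=> r_gt0; have g_gt0 : 0 < gcdn r n by rewrite gcdn_gt0 r_gt0.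
have [km kn kE _] := egcdnP n r_gt0.
have i0_lt : i %% gcdn r n < n by rewrite (leq_ltn_trans (leq_mod _ _)).
exists (i %/ gcdn r n * km), (Ordinal i0_lt); split; first exact: ltn_pmod.
apply: val_inj; rewrite val_shift_strand /= -mulnA kE mulnDr mulnA addnCA.
by rewrite modnMDl addnC -divn_eq modn_small.
Qed.

(* A crossing invariant under rotation by r is determined by what lies directly
   below the first gcd(r, n) strands, since these meet every orbit. *)
Lemma card_rotation_fixed n (r : 'I_n) : 0 < r ->
  #|[set x in vcrossings n | rotate_crossing r x == x]| <= n.+1 ^ n./2.
Proof.
move=> r_gt0; set F := [set x in _ | _].
have gn : gcdn r n <= n by rewrite dvdn_leq ?dvdn_gcdr // (leq_trans _ (ltn_ord r)).
pose w := @widen_ord _ _ gn.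
pose enc (x : crossing_data n) : {ffun 'I_(gcdn r n) -> option 'I_n} :=
  [ffun i => [pick j | covers x.2 (w i) j]].
have encE x i j : x \in F -> (enc x i == Some j) = covers x.2 (w i) j.
  rewrite !inE => /andP[/andP[partx linx] _]; rewrite ffunE.
  case: pickP => [k ck|/(_ j) -> //].
  apply/eqP/idP => [[<-] //|cj].
  by rewrite (covers_unique linx partx ck cj).
have sub_enc x y : x \in F -> y \in F -> enc x = enc y ->
    forall i j, covers x.2 i j -> covers y.2 i j.
  move=> xF yF xy i j.
  have [a [i0 [i0_lt ->]]] := orbit_representative i r_gt0.
  have [j0 ->] := shift_strand_surj (a * r) j.
  have xr : rotate_crossing r x = x by case/setIdP: (xF) => _ /eqP.
  have yr : rotate_crossing r y = y by case/setIdP: (yF) => _ /eqP.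
  rewrite -{1}(rotate_crossingM a xr) -{1}(rotate_crossingM a yr) !covers_rotate.
  have -> : i0 = w (Ordinal i0_lt) by apply: val_inj.
  by rewrite -!encE // xy.
have enc_inj : {in F &, injective enc}.
  move=> x y xF yF xy.
  have [xV yV] : x \in vcrossings n /\ y \in vcrossings n.
    by case/setIdP: xF => ? _; case/setIdP: yF.
  apply: vcrossing_order_inj => //.
  move: (xV) (yV); rewrite !inE => /andP[_ linx] /andP[_ liny].
  apply/eqP; rewrite eqEsubset (covers_sub linx liny (sub_enc _ _ xF yF xy)).
  by rewrite (covers_sub liny linx (sub_enc _ _ yF xF (esym xy))).
rewrite -(card_in_imset enc_inj).
apply: leq_trans (max_card _) _; rewrite card_ffun card_option !card_ord.
rewrite leq_exp2l; last by rewrite ltnS (leq_ltn_trans (leq0n r)).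
have g_le_r : gcdn r n <= r by rewrite dvdn_leq ?dvdn_gcdl.
have /dvdnP[q nE] := dvdn_gcdr r n.
(* The gcd is at most r < n, hence a proper divisor of n, hence at most n/2. *)
have q_gt1 : 1 < q.
  have n_gt0 : 0 < n by apply: leq_ltn_trans (ltn_ord r).
  have g_lt_n := leq_ltn_trans g_le_r (ltn_ord r).
  case: q {g_le_r} nE => [|[|q]] // nE.
    by move: n_gt0; rewrite {1}nE mul0n ltnn.
  by move: g_lt_n; rewrite [X in _ < X]nE mul1n ltnn.
by rewrite geq_half_double -mul2n (leq_trans (leq_mul q_gt1 (leqnn _))) // -nE.
Qed.

Lemma card_nonfree n : #|nonfree n| <= n * n.+1 ^ n./2.
Proof.
pose F (r : 'I_n) := [set x in vcrossings n | (0 < r) && (rotate_crossing r x == x)].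
have -> : nonfree n = \bigcup_r F r.
  apply/setP => x; apply/setIdP/bigcupP => [[xV /existsP[r xr]]|[r _]].
    by exists r; rewrite // inE xV.
  by case/setIdP=> xV xr; split=> //; apply/existsP; exists r.
apply: leq_trans (_ : \sum_(r < n) #|F r| <= _).
  elim/big_rec2: _ => [|r m A _ le_Am]; first by rewrite cards0.
  by rewrite (leq_trans (leq_card_setU _ _)) // leq_add2l.
rewrite -[X in _ <= X * _]card_ord -sum_nat_const; apply: leq_sum => r _.
have [r0|r_gt0] := posnP (r : nat).
  by rewrite eq_card0 // => x; rewrite inE r0 andbF.
apply: leq_trans (card_rotation_fixed r_gt0).
by apply/subset_leq_card/subsetP => x; rewrite !inE r_gt0.
Qed.

From mathcomp Require Import all_classical all_reals all_analysis.
From mathcomp Require Import ring lra.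
Import Order.TTheory GRing.Theory Num.Theory.
Import numFieldNormedType.Exports.
Local Open Scope classical_set_scope.
Local Open Scope ring_scope.

(** * Wallis' product *)

Section wallis.
Variable R : realType.
Implicit Types x : R.

(* The antiderivative of cos ^+ m vanishing at 0: its value at pi / 2 is Wallis'
   integral. *)
Fixpoint cos_prim (m : nat) (x : R) : R :=
  match m with
  | 0 => x
  | 1 => sin x
  | m'.+2 => (sin x * cos x ^+ m'.+1 + m'.+1%:R * cos_prim m' x) / m'.+2%:R
  end.

Lemma cos_prim0 m : cos_prim m 0 = 0.
Proof.
have [n] := ubnP m; elim: n m => // n IHn [|[|m]] //= mn; first exact: sin0.
by rewrite sin0 mul0r add0r IHn ?mulr0 ?mul0r // -ltnS ltnW.
Qed.

(** This is the reduction formula from integration by parts; after differentiating, sin^2 = 1 -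
    cos^2 leaves only powers of the cosine. *)
Lemma is_derive_cos_prim m x : is_derive x 1 (cos_prim m) (cos x ^+ m).
Proof.
have [n] := ubnP m; elim: n m => // n IHn [|[|m]] mn.
- by rewrite expr0; exact: is_derive_id.
- by rewrite expr1; exact: is_derive_sin.
have dm : is_derive x 1 (cos_prim m) (cos x ^+ m) by apply: IHn; rewrite -ltnS ltnW.
rewrite [cos_prim _](_ : _ = fun y => m.+2%:R^-1 *
    (sin y * cos y ^+ m.+1 + m.+1%:R * cos_prim m y)); last first.
  by apply/funext => y; rewrite /= [RHS]mulrC.
move: (cos_prim m) dm => G dG.
have dX := @is_deriveX R R cos m.+1 x 1 _ (is_derive_cos x).
have dM := is_deriveM (is_derive_sin x) dX.
have dZ := is_deriveZ m.+1%:R dG.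
have dD := is_deriveZ m.+2%:R^-1 (is_deriveD dM dZ).
rewrite [F in is_derive _ _ F](_ : _ = m.+2%:R^-1 \*:
    (sin * (cos : R -> R) ^+ m.+1 + m.+1%:R \*: G)); last first.
  by apply/funext => y; rewrite /= !fctE.
apply: (@is_derive_eq _ _ _ _ _ _ _ _ dD).
rewrite !fctE /GRing.scale /=.
have -> : sin x * (m.+1%:R * cos x ^+ m * - sin x)
    = - (m.+1%:R * cos x ^+ m * (1 - cos x ^+ 2)).
  by rewrite -sin2cos2; ring.
have m2 : m.+2%:R != 0 :> R by rewrite pnatr_eq0.
apply: (mulfI m2); rewrite mulVKf // !exprS -[m.+2%:R]natr1 -[m.+1%:R]natr1; ring.
Qed.

Definition wallis m : R := cos_prim m (pi / 2).

Lemma wallisS m : m.+2%:R * wallis m.+2 = m.+1%:R * wallis m.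
Proof.
by rewrite /wallis /= cos_pihalf exprS mul0r mulr0 add0r mulrC divfK // pnatr_eq0.
Qed.

(** On [0, pi/2] the cosine lies in [0, 1], so its powers decrease; the mean value theorem transfers
    this to the antiderivatives. *)
Lemma wallis_le m : wallis m.+1 <= wallis m.
Proof.
have pi2 : 0 <= pi / 2 :> R by rewrite divr_ge0 ?pi_ge0.
pose f x := cos_prim m x - cos_prim m.+1 x.
have df x : is_derive x 1 f (cos x ^+ m - cos x ^+ m.+1).
  by apply: is_deriveB; apply: is_derive_cos_prim.
have [c|c cI] := @MVT_segment R f _ 0 (pi / 2) pi2 (fun x _ => df x).
  apply: continuous_subspaceT => x.
  exact/differentiable_continuous/derivable1_diffP/ex_derive.
rewrite /f !cos_prim0 subr0 subr0 => fE; rewrite -subr_ge0 fE.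
apply: mulr_ge0; last by rewrite subr0.
rewrite exprS -{1}[cos c ^+ m]mul1r -mulrBl mulr_ge0 ?subr_ge0 ?cos_le1 //.
apply/exprn_ge0/cos_ge0_pihalf; move: cI; rewrite in_itv /= => /andP[c0 ->].
by rewrite andbT (le_trans _ c0) // oppr_le0.
Qed.

Lemma wallis_gt0 m : 0 < wallis m.
Proof.
have [n] := ubnP m; elim: n m => // n IHn [|[|m]] mn.
- by rewrite /wallis /= divr_gt0 ?pi_gt0.
- by rewrite /wallis /= sin_pihalf.
- rewrite -(@pmulr_rgt0 _ m.+2%:R) // wallisS mulr_gt0 // IHn // -ltnS ltnW //.
Qed.

(** By [wallisS] the left side does not change from m to m + 1. *)
Lemma wallis_prod m : m.+1%:R * (wallis m * wallis m.+1) = pi / 2.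
Proof.
elim: m => [|m IHm]; first by rewrite mul1r /wallis /= sin_pihalf mulr1.
by rewrite -IHm mulrCA wallisS; ring.
Qed.

(** The probability of exactly k heads in 2k fair coin tosses. *)
Definition cbin_ratio k : R := 'C(k.*2, k)%:R / 4 ^+ k.

Lemma cbin_ratio_ge0 k : 0 <= cbin_ratio k.
Proof. by rewrite divr_ge0 // exprn_ge0. Qed.

Lemma cbin_ratioE k : cbin_ratio k = k.*2`!%:R / (k`!%:R ^+ 2 * 4 ^+ k).
Proof.
have kf : k`!%:R != 0 :> R by rewrite pnatr_eq0 -lt0n fact_gt0.
have kk : k.*2 = (k + k)%N by rewrite addnn.
have := @bin_fact k.*2 k; rewrite {1 3}kk leq_addr addnK => /(_ isT) <-.
by rewrite /cbin_ratio !natrM; field; rewrite kf expf_neq0.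
Qed.

Lemma cbin_ratioS k :
  k.+1.*2%:R * cbin_ratio k.+1 = k.*2.+1%:R * cbin_ratio k.
Proof.
have kf : k`!%:R != 0 :> R by rewrite pnatr_eq0 -lt0n fact_gt0.
have k1 : k%:R + 1 != 0 :> R by rewrite natr1 pnatr_eq0.
rewrite !cbin_ratioE doubleS !factS !natrM [4 ^+ k.+1]exprS.
rewrite -[k.*2.+2%:R]natr1 -[k.*2.+1%:R]natr1 -[k.+1%:R]natr1.
rewrite -[in k.*2%:R]muln2 natrM.
by field; rewrite kf k1 expf_neq0.
Qed.

Lemma cbin_ratio_wallis k : cbin_ratio k * (pi / 2) = wallis k.*2.
Proof.
elim: k => [|k IHk]; first by rewrite cbin_ratioE /= fact0 expr1n expr0 mulr1 divr1 mul1r.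
have k2 : k.+1.*2%:R != 0 :> R by rewrite pnatr_eq0.
apply: (mulfI k2); rewrite [_ * (cbin_ratio _ * _)]mulrA cbin_ratioS -mulrA IHk doubleS wallisS //.
Qed.

(** Monotonicity in [wallis_prod] at index 2k gives pi/2 <= (2k+1) W^2, where W is Wallis' integral
    of index 2k. *)
Lemma cbin_ratio_lb k : (pi * (k%:R + 2^-1))^-1 <= cbin_ratio k ^+ 2.
Proof.
have pi0 := pi_gt0 R.
have -> : cbin_ratio k = wallis k.*2 * (2 / pi).
  by rewrite -cbin_ratio_wallis; move: pi pi0 => p p0; field; rewrite gt_eqF.
have := wallis_prod k.*2; have := wallis_le k.*2; have := wallis_gt0 k.*2.
set a := wallis _; set b := wallis _ => a0 ba ab.
have k0 : 0 <= k%:R :> R by [].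
have aab : pi / 2 <= (2 * k%:R + 1) * (a * a).
  rewrite (_ : 2 * k%:R + 1 = k.*2.+1%:R); last by rewrite -[k.*2.+1%:R]natr1 -mul2n natrM.
  by rewrite -ab !ler_wpM2l // ltW.
have k12 : 0 < k%:R + 2^-1 :> R by rewrite ltr_wpDl ?invr_gt0.
rewrite -div1r ler_pdivrMr ?mulr_gt0 //.
rewrite [X in _ <= X](_ : _ = 2 / pi * ((2 * k%:R + 1) * (a * a))); last first.
  by move: pi pi0 => p p0; field; rewrite gt_eqF.
have e1 : 2 / pi * (pi / 2) = 1 :> R.
  by move: pi pi0 => p p0; field; rewrite gt_eqF.
rewrite -[X in X <= _]e1; apply: ler_wpM2l aab.
by rewrite divr_ge0 // ltW.
Qed.

(** As for the lower bound, but with [wallis_prod] at the odd index 2k+1, so that the even integral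
    is the smaller factor. *)
Lemma cbin_ratio_ub k : cbin_ratio k.+1 ^+ 2 <= (pi * k.+1%:R)^-1.
Proof.
have pi0 := pi_gt0 R.
have -> : cbin_ratio k.+1 = wallis k.+1.*2 * (2 / pi).
  by rewrite -cbin_ratio_wallis; move: pi pi0 => p p0; field; rewrite gt_eqF.
rewrite doubleS.
have := wallis_prod k.*2.+1; have := wallis_le k.*2.+1; have := wallis_gt0 k.*2.+2.
set a := wallis _; set b := wallis _ => a0 ba ab.
have aab : (2 * k.+1%:R) * (a * a) <= pi / 2.
  rewrite -ab -doubleS -mul2n natrM ler_wpM2l ?mulr_ge0 //.
  by rewrite ler_wpM2r // ltW.
rewrite -[X in _ <= X]div1r ler_pdivlMr ?mulr_gt0 //.
rewrite [X in X <= _](_ : _ = 2 / pi * ((2 * k.+1%:R) * (a * a))); last first.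
  by move: pi pi0 => p p0; field; rewrite gt_eqF.
have e1 : 2 / pi * (pi / 2) = 1 :> R.
  by move: pi pi0 => p p0; field; rewrite gt_eqF.
rewrite -[X in _ <= X]e1; apply: ler_wpM2l aab.
by rewrite divr_ge0 // ltW.
Qed.

Lemma cbin_ratio_le1 k : cbin_ratio k <= 1.
Proof.
elim: k => [|k IHk]; first by rewrite cbin_ratioE /= fact0 expr1n expr0 mulr1 divr1.
have k2 : 0 < k.+1.*2%:R :> R by rewrite ltr0n.
rewrite -(ler_pM2l k2) cbin_ratioS ler_pM ?cbin_ratio_ge0 // ler_nat.
by rewrite doubleS.
Qed.

End wallis.

(** * Concentration *)

Section sinh_weights.
Variables (R : realType) (s : R).
Hypothesis s_gt0 : 0 < s.

Definition sinh_term (j : nat) : R := (2 * s) ^+ j.*2.+1 / j.*2.+1`!%:R.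
Definition sinh_sum (M : nat) : R := \sum_(j < M) sinh_term j.
Definition sinh2 : R := (expR (2 * s) - expR (- (2 * s))) / 2.

Lemma sinh_term_ge0 j : 0 <= sinh_term j.
Proof. by rewrite divr_ge0 ?exprn_ge0 ?mulr_ge0 // ltW. Qed.

Lemma sinh_sumS M : sinh_sum M.+1 = sinh_sum M + sinh_term M.
Proof. by rewrite /sinh_sum big_ord_recr. Qed.

(** In the difference of the exponential series at 2s and -2s the even terms cancel and the odd ones
    double. *)
Lemma sinh_sum_exp M :
  sinh_sum M = (series (exp_coeff (2 * s)) M.*2 - series (exp_coeff (- (2 * s))) M.*2) / 2.
Proof.
elim: M => [|M IHM]; first by rewrite /sinh_sum big_ord0 /series /= !big_geq // subrr mul0r.
rewrite sinh_sumS IHM doubleS /series /= !big_nat_recr //= /exp_coeff /=.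
rewrite !exprS !mulNr /sinh_term exprS.
have -> : (- (2 * s)) ^+ M.*2 = (2 * s) ^+ M.*2.
  by rewrite -mul2n !exprM sqrrN.
set a := \sum_(_ <= _ < _) _; set b := \sum_(_ <= _ < _) _; set d := _ ^+ _.
by field; rewrite !pnatr_eq0 -!lt0n !fact_gt0.
Qed.

Lemma cvg_double_index : (fun M => M.*2) @ \oo --> \oo.
Proof.
apply/cvgnyPge => A; near=> M.
have : (A <= M)%N by near: M; exact: nbhs_infty_ge.
by move=> AM; rewrite (leq_trans AM) // -addnn leq_addr.
Unshelve. all: by end_near. Qed.

Lemma cvg_sinh_sum : sinh_sum @ \oo --> sinh2.
Proof.
rewrite (_ : sinh_sum = fun M => (series (exp_coeff (2 * s)) M.*2 -
    series (exp_coeff (- (2 * s))) M.*2) / 2); last by apply/funext; exact: sinh_sum_exp.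
apply: cvgMl; apply: cvgB.
  apply: (cvg_comp _ _ cvg_double_index); exact: is_cvg_series_exp_coeff.
apply: (cvg_comp _ _ cvg_double_index); exact: is_cvg_series_exp_coeff.
Qed.

Lemma cvg_sinh_term : sinh_term @ \oo --> 0.
Proof.
have -> : sinh_term = (fun M => sinh_sum M.+1 - sinh_sum M).
  by apply/funext => M; rewrite sinh_sumS addrC addKr.
rewrite -(subrr sinh2); apply: cvgB; last exact: cvg_sinh_sum.
by rewrite (cvg_shiftS sinh_sum); exact: cvg_sinh_sum.
Qed.

Lemma sinh_sum_le M : sinh_sum M <= sinh2.
Proof.
have nd : nondecreasing_seq sinh_sum.
  by apply/nondecreasing_seqP => k; rewrite sinh_sumS lerDl sinh_term_ge0.
rewrite -(cvg_lim _ cvg_sinh_sum) //; apply: nondecreasing_cvgn_le => //.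
by apply/cvg_ex; exists sinh2; exact: cvg_sinh_sum.
Qed.

Lemma sinh2_gt0 : 0 < sinh2.
Proof.
apply: lt_le_trans (sinh_sum_le 1); rewrite /sinh_sum big_ord1 /sinh_term /=.
by rewrite divr_gt0 // exprn_gt0 // mulr_gt0.
Qed.

(* Its mean under the weights [sinh_term] is exactly 1, by the shift identity
   [sinh_termS]. *)
Definition sinh_stat (j : nat) : R := j%:R * (2 * j%:R + 1) / (2 * s ^+ 2).

Lemma sinh_termS j : sinh_term j.+1 * sinh_stat j.+1 = sinh_term j.
Proof.
rewrite /sinh_term /sinh_stat doubleS !factS !natrM !exprS.
rewrite -[j.*2.+3%:R]natr1 -[j.*2.+2%:R]natr1 -[j.+1%:R]natr1.
rewrite -[j.*2.+1%:R]natr1 -[in j.*2%:R]muln2 natrM.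
have j0 : 0 <= j%:R :> R by [].
have jf : j.*2`!%:R != 0 :> R by rewrite pnatr_eq0 -lt0n fact_gt0.
move: (j%:R : R) j0 => x x0; field.
by rewrite jf (gt_eqF s_gt0) /=; apply/and3P; split; rewrite gt_eqF //; lra.
Qed.

Lemma sinh_stat0 : sinh_stat 0 = 0.
Proof. by rewrite /sinh_stat !mul0r. Qed.

Lemma sinh_statS j : sinh_stat j.+1 = sinh_stat j + (4 * j%:R + 3) / (2 * s ^+ 2).
Proof. by rewrite /sinh_stat -natr1; field; rewrite gt_eqF. Qed.

Lemma sinh_mean M : \sum_(j < M.+1) (sinh_term j * sinh_stat j) = sinh_sum M.
Proof.
rewrite big_ord_recl sinh_stat0 mulr0 add0r.
by apply: eq_bigr => j _; rewrite lift0 sinh_termS.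
Qed.

(** Completing the square bounds j by s/2 * ([sinh_stat] j + 1), whose mean is known because
    [sinh_stat] has mean 1. *)
Lemma sinh_mean_index M : \sum_(j < M.+1) sinh_term j * j%:R <= s * sinh_sum M.+1.
Proof.
have le1 j : j%:R <= s / 2 * (sinh_stat j + 1).
  rewrite -subr_ge0.
  rewrite (_ : _ - _ = ((j%:R - s) ^+ 2 + j%:R / 2) / (2 * s)).
    by rewrite divr_ge0 ?addr_ge0 ?sqr_ge0 // mulr_ge0 // ltW.
  by rewrite /sinh_stat; field; rewrite gt_eqF.
apply: (@le_trans _ _ (s / 2 * \sum_(j < M.+1) (sinh_term j * sinh_stat j + sinh_term j))).
  rewrite big_distrr /=; apply: ler_sum => j _.
  rewrite (_ : s / 2 * _ = sinh_term j * (s / 2 * (sinh_stat j + 1))); last by ring.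
  by rewrite ler_wpM2l ?sinh_term_ge0.
rewrite big_split /= sinh_mean -/(sinh_sum M.+1) -mulrA; apply: ler_wpM2l; first exact: ltW.
have := sinh_term_ge0 M; rewrite sinh_sumS; lra.
Qed.

(** Shifting the index once in the second moment replaces one factor [sinh_stat] by an increment, so
    the variance is the mean of (4j+3)/(2s^2). This is at most (4s+3)/(2s^2), hence at most 7/(2s)
    for s >= 1. *)
Lemma sinh_variance M : 1 <= s ->
  \sum_(j < M) sinh_term j * (sinh_stat j - 1) ^+ 2 <= 7 / (2 * s) * sinh2.
Proof.
move=> s_ge1.
have step k : \sum_(j < k.+2) sinh_term j * (sinh_stat j - 1) ^+ 2
    <= sinh_term k.+1 + 7 / (2 * s) * sinh2.
  have -> : \sum_(j < k.+2) sinh_term j * (sinh_stat j - 1) ^+ 2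
      = \sum_(j < k.+2) (sinh_term j * sinh_stat j * sinh_stat j)
        - 2 * \sum_(j < k.+2) (sinh_term j * sinh_stat j) + sinh_sum k.+2.
    rewrite big_distrr /= -sumrB -big_split /=.
    by apply: eq_bigr => j _; ring.
  rewrite sinh_mean.
  have -> : \sum_(j < k.+2) (sinh_term j * sinh_stat j * sinh_stat j)
      = sinh_sum k + (2 * s ^+ 2)^-1 *
          (4 * \sum_(j < k.+1) sinh_term j * j%:R + 3 * sinh_sum k.+1).
    rewrite big_ord_recl sinh_stat0 mulr0 add0r -(sinh_mean k) [sinh_sum k.+1]/sinh_sum.
    rewrite 2!big_distrr /= -big_split /= big_distrr /= -big_split /=.
    apply: eq_bigr => j _; rewrite -[bump 0 j]/(j.+1) sinh_termS sinh_statS.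
    by field; rewrite gt_eqF.
  have mi := sinh_mean_index k; have le2 := sinh_sum_le k.+1.
  have s2 : 0 < 2 * s ^+ 2 by rewrite mulr_gt0 // exprn_gt0.
  have u0 := sinh_term_ge0 k; have S0 := sinh2_gt0.
  have bound : (2 * s ^+ 2)^-1 *
      (4 * \sum_(j < k.+1) sinh_term j * j%:R + 3 * sinh_sum k.+1)
      <= 7 / (2 * s) * sinh2.
    rewrite ler_pdivrMl // [X in _ <= X](_ : _ = 7 * s * sinh2); last by field; rewrite gt_eqF.
    have : 0 <= s * (sinh2 - sinh_sum k.+1) by rewrite mulr_ge0 ?subr_ge0 // ltW.
    have : 0 <= (s - 1) * sinh2 by rewrite mulr_ge0 ?subr_ge0 // ltW.
    lra.
  by rewrite !sinh_sumS in bound *; lra.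
(* The truncation error in [step] vanishes in the limit, and the sum up to M is at most the longer
   sums. *)
have lim : sinh_term k.+1 + 7 / (2 * s) * sinh2 @[k --> \oo] --> 7 / (2 * s) * sinh2.
  rewrite -[X in _ --> X]add0r; apply: cvgD; last exact: cvg_cst.
  by rewrite (cvg_shiftS sinh_term); exact: cvg_sinh_term.
rewrite -(cvg_lim _ lim) //; apply: limr_ge.
  by apply/cvg_ex; eexists; exact: lim.
near=> k; apply: le_trans (step k).
have Mk : (M <= k.+2)%N.
  by near: k; exists M => // k /= Mk; rewrite (leq_trans Mk) // ltnW.
rewrite -(big_mkord xpredT (fun j => sinh_term j * (sinh_stat j - 1) ^+ 2)).
rewrite -(big_mkord xpredT (fun j => sinh_term j * (sinh_stat j - 1) ^+ 2)).
rewrite (big_cat_nat _ Mk) //= lerDl; apply: sumr_ge0 => j _.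
by rewrite mulr_ge0 ?sinh_term_ge0 ?sqr_ge0.
Unshelve. all: by end_near. Qed.

End sinh_weights.

(** * Exponential bounds for falling factorials *)

Section falling_ratio.
Variables (R : realType) (n : nat).
Hypothesis n_gt0 : (0 < n)%N.

Let nR_gt0 : 0 < n%:R :> R. Proof. by rewrite ltr0n. Qed.

Definition falling_ratio (j : nat) : R := \prod_(i < j) (1 - i.+1%:R / n%:R).

Lemma falling_ratioS j :
  falling_ratio j.+1 = falling_ratio j * (1 - j.+1%:R / n%:R).
Proof. by rewrite /falling_ratio big_ord_recr. Qed.

Lemma falling_ratio_eq0 j : (n <= j)%N -> falling_ratio j = 0.
Proof.
move=> nj; have nj' : (n.-1 < j)%N by rewrite prednK.
rewrite /falling_ratio (bigD1 (Ordinal nj')) //= prednK //.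
by rewrite divff ?gt_eqF // subrr mul0r.
Qed.

Lemma falling_ratio_ge0 j : 0 <= falling_ratio j.
Proof.
elim: j => [|j IHj]; first by rewrite /falling_ratio big_ord0.
rewrite falling_ratioS; case: (leqP n j) => [nj|jn].
  by rewrite falling_ratio_eq0 // mul0r.
by rewrite mulr_ge0 // subr_ge0 ler_pdivrMr // mul1r ler_nat.
Qed.

(** Each factor satisfies 1 - x <= exp(-x), and the numbers 1/n, ..., j/n add up to the exponent. *)
Lemma falling_ratio_le_exp j :
  falling_ratio j <= expR (- (j%:R * (j%:R + 1) / (2 * n%:R))).
Proof.
elim: j => [|j IHj].
  by rewrite /falling_ratio big_ord0 !mul0r oppr0 expR0.
case: (leqP n j) => [nj|jn].
  by rewrite falling_ratioS falling_ratio_eq0 // mul0r expR_ge0.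
have -> : - (j.+1%:R * (j.+1%:R + 1) / (2 * n%:R))
    = - (j%:R * (j%:R + 1) / (2 * n%:R)) + - (j.+1%:R / n%:R) :> R.
  by rewrite -[j.+1%:R]natr1; field; rewrite gt_eqF.
rewrite falling_ratioS expRD ler_pM ?falling_ratio_ge0 //.
  by rewrite subr_ge0 ler_pdivrMr // mul1r ler_nat.
exact: expR_ge1Dx.
Qed.

Lemma falling_ratio_le1 j : falling_ratio j <= 1.
Proof.
apply: le_trans (falling_ratio_le_exp j) _.
by rewrite expR_le1 oppr_le0 divr_ge0 ?mulr_ge0 ?addr_ge0 // ltW.
Qed.

(** Since 1 + x <= exp x, each factor satisfies exp(-x) (1 - x^2) <= 1 - x. The losses x^2 = (i/n)^2
    for i <= j add up to at most j^3/n^2. *)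
Lemma falling_ratio_ge_exp j : (j <= n)%N ->
  expR (- (j%:R * (j%:R + 1) / (2 * n%:R))) * (1 - j%:R ^+ 3 / n%:R ^+ 2)
    <= falling_ratio j.
Proof.
elim: j => [|j IHj] jn.
  by rewrite /falling_ratio big_ord0 !mul0r oppr0 expR0 expr0n mul0r subr0 mulr1.
have {IHj} := IHj (ltnW jn).
have -> : - (j.+1%:R * (j.+1%:R + 1) / (2 * n%:R))
    = - (j%:R * (j%:R + 1) / (2 * n%:R)) + - (j.+1%:R / n%:R) :> R.
  by rewrite -[j.+1%:R]natr1; field; rewrite gt_eqF.
rewrite falling_ratioS expRD.
have x0 : 0 <= j.+1%:R / n%:R :> R by rewrite divr_ge0.
have x1 : j.+1%:R / n%:R <= 1 :> R by rewrite ler_pdivrMr // mul1r ler_nat.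
have e1 := expR_ge0 (- (j%:R * (j%:R + 1) / (2 * n%:R)) : R).
have g0 := falling_ratio_ge0 j.
have cube : j%:R ^+ 3 / n%:R ^+ 2 + (j.+1%:R / n%:R) ^+ 2 <= j.+1%:R ^+ 3 / n%:R ^+ 2 :> R.
  rewrite expr_div_n -mulrDl ler_wpM2r ?invr_ge0 ?exprn_ge0 // -natr1.
  have j0 : 0 <= j%:R :> R by [].
  rewrite -subr_ge0 (_ : _ - _ = 2 * j%:R ^+ 2 + j%:R); last by ring.
  by rewrite addr_ge0 // mulr_ge0 // exprn_ge0.
have ex : expR (- (j.+1%:R / n%:R)) * (1 - (j.+1%:R / n%:R) ^+ 2) <= 1 - j.+1%:R / n%:R :> R.
  set x := j.+1%:R / n%:R in x0 x1 *.
  rewrite expRN ler_pdivrMl ?expR_gt0 // (_ : 1 - x ^+ 2 = (1 + x) * (1 - x)); last by ring.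
  by rewrite ler_wpM2r ?subr_ge0 // expR_ge1Dx.
have a0 : 0 <= j%:R ^+ 3 / n%:R ^+ 2 :> R by rewrite divr_ge0 ?exprn_ge0.
move: a0 x0 x1 e1 g0 cube ex (expR_ge0 (- (j.+1%:R / n%:R) : R)).
move: (expR (- (j%:R * (j%:R + 1) / (2 * n%:R)))) (falling_ratio j) => e g.
move: (expR (- (j.+1%:R / n%:R))) => f.
move: (j%:R ^+ 3 / n%:R ^+ 2) (j.+1%:R ^+ 3 / n%:R ^+ 2) => a b.
move: (j.+1%:R / n%:R) => x a0 x0 x1 e0 g0 cube ex f0 IHj.
(* Once a = j^3/n^2 exceeds 1, the left side of the claim is not positive. *)
have [a1|a1] := leP 0 (1 - a); last first.
  apply: (@le_trans _ _ 0); last by rewrite mulr_ge0 // subr_ge0.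
  rewrite mulr_ge0_le0 ?mulr_ge0 //; have := sqr_ge0 x; lra.
apply: (@le_trans _ _ (e * (1 - a) * (f * (1 - x ^+ 2)))).
  rewrite (_ : e * (1 - a) * _ = e * f * ((1 - a) * (1 - x ^+ 2))); last by ring.
  rewrite ler_wpM2l ?mulr_ge0 //.
  have := mulr_ge0 a0 (sqr_ge0 x); lra.
apply: (@le_trans _ _ (e * (1 - a) * (1 - x))).
  by rewrite ler_wpM2l // mulr_ge0.
by rewrite ler_wpM2r // subr_ge0.
Qed.

Lemma ffact_falling_ratio j : (n.-1 ^_ j)%:R = n%:R ^+ j * falling_ratio j :> R.
Proof.
elim: j => [|j IHj]; first by rewrite ffactn0 /falling_ratio big_ord0 mulr1.
rewrite ffactnSr natrM IHj falling_ratioS exprSr.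
case: (leqP n j) => [nj|jn]; first by rewrite falling_ratio_eq0 // mulr0 !mul0r mulr0.
rewrite natrB; last by rewrite -ltnS prednK.
have -> : n.-1%:R = n%:R - 1 :> R by rewrite -{2}(prednK n_gt0) -natr1 addrK.
by rewrite -[j.+1%:R]natr1; field; rewrite gt_eqF.
Qed.

Lemma bin_sinh_term j : let s := Num.sqrt n%:R : R in
  'C(n.-1, j)%:R / j.+1`!%:R
    = s^-1 * (sinh_term s j * (cbin_ratio R j.+1 * falling_ratio j)).
Proof.
move=> s; have s_gt0 : 0 < s by rewrite sqrtr_gt0.
have s2 : s ^+ 2 = n%:R by rewrite sqr_sqrtr // ltW.
have jf k : k`!%:R != 0 :> R by rewrite pnatr_eq0 -lt0n fact_gt0.
apply: (mulfI (jf j)); rewrite [LHS]mulrA -natrM mulnC bin_ffact ffact_falling_ratio.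
rewrite cbin_ratioE /sinh_term doubleS [j.*2.+2`!]factS natrM [(2 * s) ^+ _]exprS.
have -> : (2 * s) ^+ j.*2 = 4 ^+ j * n%:R ^+ j.
  by rewrite -mul2n exprM -exprMn -s2; congr (_ ^+ _); ring.
rewrite [4 ^+ j.+1]exprS factS natrM -[j.*2.+2%:R]natr1 -[j.*2.+1%:R]natr1.
rewrite -[in (j.*2)%:R + 1 + 1]muln2 [(j * 2)%:R]natrM -[j.+1%:R]natr1.
have j1 : j%:R + 1 != 0 :> R by rewrite natr1 pnatr_eq0.
by field; rewrite j1 !jf expf_neq0 // (gt_eqF s_gt0).
Qed.

End falling_ratio.

Lemma le_inv_sqrt (R : rcfType) (b c : R) :
  0 <= b -> 0 < c -> b ^+ 2 <= c^-1 -> b <= (Num.sqrt c)^-1.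
Proof.
move=> b0 c0 bc; rewrite -sqrtrV ?(ltW c0) // -(ger0_norm b0) -sqrtr_sqr.
by rewrite ler_wsqrtr.
Qed.

Lemma ge_inv_sqrt (R : rcfType) (b c : R) :
  0 <= b -> 0 < c -> c^-1 <= b ^+ 2 -> (Num.sqrt c)^-1 <= b.
Proof.
move=> b0 c0 bc; rewrite -sqrtrV ?(ltW c0) // -(ger0_norm b0) -sqrtr_sqr.
by rewrite ler_wsqrtr.
Qed.

(** * Bounds for the weighted sum by Chebyshev's inequality *)

Section mass.
Variables (R : realType) (n : nat) (d : R).
Hypothesis n_gt0 : (0 < n)%N.
Hypothesis d01 : 0 < d < 1.

Let s : R := Num.sqrt n%:R.
Let s_gt0 : 0 < s. Proof. by rewrite sqrtr_gt0 ltr0n. Qed.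
Let nE : n%:R = s ^+ 2. Proof. by rewrite sqr_sqrtr. Qed.
Let d_gt0 : 0 < d. Proof. by case/andP: d01. Qed.
Let d_lt1 : d < 1. Proof. by case/andP: d01. Qed.

Let h (j : nat) : R := cbin_ratio R j.+1 * falling_ratio R n j.
Let X (j : nat) : R := sinh_stat s j.

Let h_ge0 j : 0 <= h j.
Proof. by rewrite mulr_ge0 ?cbin_ratio_ge0 ?falling_ratio_ge0. Qed.

Let h_le1 j : h j <= 1.
Proof.
by rewrite -[1]mulr1 ler_pM ?cbin_ratio_ge0 ?falling_ratio_ge0 ?cbin_ratio_le1
           ?falling_ratio_le1.
Qed.

(** Bounds h j where X j is within d of 1: there j + 1 >= (1 - d) s and j (j + 1) >= (1 - d) n. *)
Definition mass_ub : R := expR (- ((1 - d) / 2)) / Num.sqrt (pi * (s * (1 - d))).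

(** The counterpart from below, where j <= (1 + d) s. The term 8/s bounds j^3/n^2 through j <= 2s,
    and 3/(2s) comes from the shift j + 1 + 1/2 in [cbin_ratio_lb]. *)
Definition mass_lb : R :=
  expR (- ((1 + d) * (1 + (2 * s)^-1) / 2)) * (1 - 8 / s)
    / Num.sqrt (pi * (s * (1 + d + 3 / (2 * s)))).

Let X_num j : X j * s ^+ 2 = j%:R * (2 * j%:R + 1) / 2.
Proof. by rewrite /X /sinh_stat; field; rewrite gt_eqF. Qed.

(** Chebyshev's device: where X j is farther than d from 1, the quadratic term exceeds 1 and so
    bounds h j by itself. *)
Let pointwise_ub j : h j <= mass_ub + (X j - 1) ^+ 2 / d ^+ 2.
Proof.
have sqrt0 : 0 < pi * (s * (1 - d)) by rewrite !mulr_gt0 ?pi_gt0 // subr_gt0.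
have ub0 : 0 <= mass_ub by rewrite divr_ge0 ?expR_ge0 ?sqrtr_ge0.
have j0 : 0 <= j%:R :> R by [].
have [Xd|Xd] := leP `|X j - 1| d; last first.
  apply: (le_trans (h_le1 j)); rewrite ler_wpDl // ler_pdivlMr ?exprn_gt0 // mul1r.
  rewrite -[(X j - 1) ^+ 2]real_normK ?num_real //.
  by apply: lerXn2r; rewrite ?nnegrE ?normr_ge0 ?(ltW d_gt0) ?(ltW Xd).
apply: (@le_trans _ _ mass_ub); last by rewrite lerDl divr_ge0 ?sqr_ge0.
have X1 : 1 - d <= X j by move: Xd; rewrite ler_norml; lra.
have X1s : (1 - d) * s ^+ 2 <= j%:R * (2 * j%:R + 1) / 2.
  by rewrite -X_num ler_wpM2r // exprn_ge0 // ltW.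
rewrite /h /mass_ub [X in _ <= X]mulrC ler_pM ?cbin_ratio_ge0 ?falling_ratio_ge0 //.
  apply: le_inv_sqrt => //; first exact: cbin_ratio_ge0.
  apply: (le_trans (cbin_ratio_ub _ _)).
  rewrite lef_pV2 ?posrE ?mulr_gt0 ?pi_gt0 ?subr_gt0 //.
  rewrite ler_wpM2l ?pi_ge0 // -ler_sqr ?nnegrE ?mulr_ge0 ?subr_ge0 //; try exact: ltW.
  (* X j >= 1 - d yields (j+1)^2 >= (1-d) s^2; this term is the gap down to (1-d)^2 s^2. *)
  have : 0 <= (1 - d) * d * s ^+ 2 by rewrite !mulr_ge0 ?sqr_ge0 ?subr_ge0 // ltW.
  rewrite exprMn -[j.+1%:R]natr1; nra.
apply: le_trans (falling_ratio_le_exp _ n_gt0 j) _.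
rewrite ler_expR lerN2 nE ler_pdivlMr ?mulr_gt0 ?exprn_gt0 //; nra.
Qed.

Let pointwise_lb j : 8 <= s -> mass_lb * (1 - (X j - 1) ^+ 2 / d ^+ 2) <= h j.
Proof.
move=> s8.
have s0 : s != 0 by rewrite gt_eqF.
have c_gt0 : 0 < 1 + d + 3 / (2 * s).
  by rewrite !addr_gt0 // divr_gt0 // mulr_gt0.
have sqrt0 : 0 < pi * (s * (1 + d + 3 / (2 * s))) by rewrite !mulr_gt0 ?pi_gt0.
have s8' : 0 <= 1 - 8 / s by rewrite subr_ge0 ler_pdivrMr // mul1r.
have lb0 : 0 <= mass_lb by rewrite divr_ge0 ?mulr_ge0 ?expR_ge0 ?sqrtr_ge0.
have j0 : 0 <= j%:R :> R by [].
have [Xd|Xd] := leP `|X j - 1| d; last first.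
  apply: (le_trans _ (h_ge0 j)); rewrite mulr_ge0_le0 // subr_le0.
  rewrite ler_pdivlMr ?exprn_gt0 // mul1r.
  rewrite -[(X j - 1) ^+ 2]real_normK ?num_real //.
  by apply: lerXn2r; rewrite ?nnegrE ?normr_ge0 ?(ltW d_gt0) ?(ltW Xd).
apply: (@le_trans _ _ mass_lb).
  by rewrite ler_piMr // gerBl divr_ge0 ?sqr_ge0.
have X1 : X j <= 1 + d by move: Xd; rewrite ler_norml; lra.
have X1s : j%:R * (2 * j%:R + 1) / 2 <= (1 + d) * s ^+ 2.
  by rewrite -X_num ler_wpM2r // exprn_ge0 // ltW.
have js : j%:R <= (1 + d) * s.
  rewrite -ler_sqr ?nnegrE ?mulr_ge0 ?addr_ge0 //; try exact: ltW.
  have : 0 <= (1 + d) * d * s ^+ 2 by rewrite !mulr_ge0 ?sqr_ge0 ?addr_ge0 // ltW.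
  rewrite exprMn; nra.
have j2s : j%:R <= 2 * s.
  by apply: le_trans js _; rewrite ler_pM2r //; move: d_lt1; lra.
have jn : (j <= n)%N.
  rewrite -(ler_nat R) nE; apply: le_trans j2s _; rewrite expr2 ler_pM2r //.
  by apply: le_trans s8; rewrite ler_nat.
rewrite /h /mass_lb [X in X <= _]mulrC ler_pM ?invr_ge0 ?sqrtr_ge0 //.
- by rewrite mulr_ge0 ?expR_ge0.
- apply: ge_inv_sqrt => //; first exact: cbin_ratio_ge0.
  apply: le_trans (cbin_ratio_lb _ _).
  have j12 : 0 < j.+1%:R + 2^-1 :> R by rewrite addr_gt0.
  rewrite lef_pV2 ?posrE ?mulr_gt0 ?pi_gt0 //.
  rewrite ler_wpM2l ?pi_ge0 // (_ : s * _ = (1 + d) * s + 3 / 2); last by field.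
  by rewrite -[j.+1%:R]natr1; lra.
apply: le_trans (falling_ratio_ge_exp _ n_gt0 jn); rewrite ler_pM ?expR_ge0 //.
  rewrite ler_expR lerN2 nE.
  have -> : (1 + d) * (1 + (2 * s)^-1) / 2 = ((1 + d) * s ^+ 2 + (1 + d) * s / 2) / (2 * s ^+ 2).
    by field.
  by rewrite ler_pM2r ?invr_gt0 ?mulr_gt0 ?exprn_gt0 //; lra.
rewrite lerD2l lerN2 nE ler_pdivrMr ?exprn_gt0 //.
rewrite (_ : 8 / s * _ = (2 * s) ^+ 3); last by field.
by rewrite lerXn2r // nnegrE // mulr_ge0 // ltW.
Qed.

Definition bin_mass : R :=
  \sum_(j < n) sinh_term s j * (cbin_ratio R j.+1 * falling_ratio R n j).

Lemma bin_mass_le : bin_mass <= (mass_ub + 7 / (2 * s) / d ^+ 2) * sinh2 s.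
Proof.
have s1 : 1 <= s by rewrite -[1]sqrtr1 ler_wsqrtr // ler1n.
have ub0 : 0 <= mass_ub by rewrite divr_ge0 ?expR_ge0 ?sqrtr_ge0.
apply: (@le_trans _ _ (\sum_(j < n) (mass_ub * sinh_term s j +
    d ^- 2 * (sinh_term s j * (X j - 1) ^+ 2)))).
  apply: ler_sum => j _.
  rewrite (_ : _ + _ = sinh_term s j * (mass_ub + (X j - 1) ^+ 2 / d ^+ 2)); last by ring.
  by rewrite ler_wpM2l ?sinh_term_ge0 ?pointwise_ub.
rewrite big_split /= -!big_distrr /= mulrDl.
apply: lerD; first by rewrite ler_wpM2l // sinh_sum_le.
rewrite [7 / _ / _]mulrC -mulrA; apply: ler_wpM2l.
  by rewrite invr_ge0 exprn_ge0 // ltW.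
exact: sinh_variance.
Qed.

Lemma bin_mass_ge : 8 <= s ->
  mass_lb * (1 - 7 / (2 * s) / d ^+ 2) * sinh2 s <= bin_mass.
Proof.
move=> s8; have s1 : 1 <= s by apply: le_trans s8; lra.
have s8' : 0 <= 1 - 8 / s by rewrite subr_ge0 ler_pdivrMr // mul1r.
have lb0 : 0 <= mass_lb by rewrite divr_ge0 ?mulr_ge0 ?expR_ge0 ?sqrtr_ge0.
(* The sum may run to any M >= n, as [falling_ratio] vanishes from n on; letting M grow completes
   [sinh_sum] to [sinh2]. *)
have step M : (n <= M)%N ->
    mass_lb * (sinh_sum s M - 7 / (2 * s) / d ^+ 2 * sinh2 s) <= bin_mass.
  move=> nM.
  have -> : bin_mass = \sum_(j < M) sinh_term s j * h j.
    rewrite /bin_mass -!(big_mkord xpredT (fun j => sinh_term s j * h j)) /=.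
    rewrite (big_cat_nat _ nM) //= [X in _ + X]big1_seq ?addr0 // => j /andP[_].
    by rewrite mem_index_iota => /andP[nj _]; rewrite /h falling_ratio_eq0 // !mulr0.
  apply: (@le_trans _ _ (\sum_(j < M)
      mass_lb * (sinh_term s j - d ^- 2 * (sinh_term s j * (X j - 1) ^+ 2)))).
    rewrite -big_distrr /= ler_wpM2l // sumrB lerB //.
    rewrite -big_distrr /= [7 / _ / _]mulrC -mulrA ler_wpM2l //.
      by rewrite invr_ge0 exprn_ge0 // ltW.
    exact: sinh_variance.
  apply: ler_sum => j _.
  rewrite (_ : mass_lb * _ = sinh_term s j *
      (mass_lb * (1 - (X j - 1) ^+ 2 / d ^+ 2))); last by ring.
  by rewrite ler_wpM2l ?sinh_term_ge0 ?pointwise_lb.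
have lim : mass_lb * (sinh_sum s M - 7 / (2 * s) / d ^+ 2 * sinh2 s) @[M --> \oo]
    --> mass_lb * (sinh2 s - 7 / (2 * s) / d ^+ 2 * sinh2 s).
  by apply: cvgMr; apply: cvgB; [exact: cvg_sinh_sum|exact: cvg_cst].
rewrite (_ : _ * _ * _ = mass_lb * (sinh2 s - 7 / (2 * s) / d ^+ 2 * sinh2 s)); last by ring.
rewrite -(cvg_lim _ lim) //; apply: limr_le.
  by apply/cvg_ex; eexists; exact: lim.
by near=> M; apply: step; near: M; exact: nbhs_infty_ge.
Unshelve. all: by end_near. Qed.

End mass.

(** * Limits *)

Lemma card_vcrossings_mass (R : realType) n : (0 < n)%N ->
  #|vcrossings n|%:R / n`!%:R = (Num.sqrt n%:R)^-1 * bin_mass R n.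
Proof.
case: n => // n _; rewrite card_vcrossings_sum big_ord_recl.
have fn0 k : k`!%:R != 0 :> R by rewrite pnatr_eq0 -lt0n fact_gt0.
(* The term with 0 parts vanishes; the others are reindexed by k = j + 1. *)
have := @card_vcrossings_parts n 0 isT; rewrite subn0 bin_small // muln0 fact0 muln1 => ->.
rewrite add0n natr_sum big_distrl /bin_mass big_distrr; apply: eq_bigr => j _.
apply: etrans (@bin_sinh_term R n.+1 isT j); rewrite lift0.
have := @card_vcrossings_parts n j.+1 (ltn_ord j); rewrite subSS bin_sub -1?ltnS //.
move/(congr1 (fun m => m%:R : R)); rewrite natrM [in RHS]natrM => fE.
apply: (mulIf (fn0 j.+1)); rewrite mulrAC fE divfK //.
by rewrite mulrAC divff // mul1r.
Qed.

Section limits.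
Variable R : realType.

Lemma cvg_invn : (n%:R^-1 : R) @[n --> \oo] --> (0 : R).
Proof.
apply/gtr0_cvgV0; last exact: cvgr_idn.
by near=> n; rewrite ltr0n; near: n; exact: nbhs_infty_gt.
Unshelve. all: by end_near. Qed.

(* Equals s^(-1/4) for s = sqrt n.  The deviation d = s^(-1/8) allowed below
   tends to 0 while the Chebyshev tail 1 / (s d^2) is still o(s^(-1/2)). *)
Definition window n : R := Num.sqrt (Num.sqrt (Num.sqrt n%:R^-1)).

Lemma cvg_sqrt (u : R^nat) (l : R) :
  u @ \oo --> l -> Num.sqrt (u n) @[n --> \oo] --> Num.sqrt l.
Proof. by move=> ul; apply: continuous_cvg => //; exact: sqrt_continuous. Qed.

Lemma cvg_expR (u : R^nat) (l : R) :
  u @ \oo --> l -> expR (u n) @[n --> \oo] --> expR l.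
Proof. by move=> ul; apply: continuous_cvg => //; exact: continuous_expR. Qed.

Lemma cvg_window : window @ \oo --> (0 : R).
Proof.
rewrite [X in _ --> X](_ : _ = Num.sqrt (Num.sqrt (Num.sqrt 0))).
  by do 3![apply: cvg_sqrt]; exact: cvg_invn.
by rewrite !sqrtr0.
Qed.

Lemma window4 n : window n ^+ 4 = (Num.sqrt n%:R)^-1.
Proof.
rewrite (exprM _ 2 2) !sqr_sqrtr ?sqrtr_ge0 //.
by rewrite sqrtrV.
Qed.

Lemma cvg_bin_mass :
  Num.sqrt (pi * Num.sqrt n%:R) * bin_mass R n / sinh2 (Num.sqrt n%:R)
    @[n --> \oo] --> expR (- (1 / 2) : R).
Proof.
pose d n := Num.sqrt (window n).
(* With w = [window] n one has 1/s = w^4 and d^2 = w, so the tail 1/(s d^2) is w^3. In [up] the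
   normalisation sqrt (pi s) = sqrt pi / w^2 turns it into a multiple of w. *)
pose lo n := expR (- ((1 + d n) * (1 + window n ^+ 4 / 2) / 2)) * (1 - 8 * window n ^+ 4)
  / Num.sqrt (1 + d n + 3 / 2 * window n ^+ 4) * (1 - 7 / 2 * window n ^+ 3).
pose up n := expR (- ((1 - d n) / 2)) / Num.sqrt (1 - d n)
  + Num.sqrt pi * (7 / 2 * window n).
have w0 := cvg_window.
have d0 : d @ \oo --> (0 : R) by rewrite -(sqrtr0 R); exact: cvg_sqrt.
have wX k : window n ^+ k.+1 @[n --> \oo] --> (0 : R).
  rewrite -[X in _ --> X](expr0n R k.+1).
  by apply: (continuous_cvg _ (@exprn_continuous R k.+1 0)).
have up_lim : up @ \oo --> expR (- (1 / 2)).
  rewrite [X in _ --> X](_ : _ = expR (- ((1 - 0) / 2)) / Num.sqrt (1 - 0)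
     + Num.sqrt pi * (7 / 2 * 0)); last by rewrite subr0 sqrtr1 divr1 !mulr0 addr0.
  apply: cvgD; last by apply: cvgMr; exact: cvgMr.
  apply: cvgM; first by apply: cvg_expR; apply: cvgN; apply: cvgMl; apply: cvgB => //; exact: cvg_cst.
  apply: cvgV; first by rewrite subr0 sqrtr1 oner_neq0.
  by apply: cvg_sqrt; apply: cvgB => //; exact: cvg_cst.
have lo_lim : lo @ \oo --> expR (- (1 / 2)).
  rewrite [X in _ --> X](_ : _ = expR (- ((1 + 0) * (1 + 0 / 2) / 2)) * (1 - 8 * 0)
     / Num.sqrt (1 + 0 + 3 / 2 * 0) * (1 - 7 / 2 * 0)); last first.
    by rewrite !(mulr0, mul0r, addr0, subr0, sqrtr1, divr1, mulr1).
  apply: cvgM; last by apply: cvgB; [exact: cvg_cst|exact: cvgMr].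
  apply: cvgM.
    apply: cvgM; last by apply: cvgB; [exact: cvg_cst|exact: cvgMr].
    apply: cvg_expR; apply: cvgN; apply: cvgMl; apply: cvgM.
      by apply: cvgD => //; exact: cvg_cst.
    by apply: cvgD; [exact: cvg_cst|exact: cvgMl].
  apply: cvgV; first by rewrite !(mulr0, addr0) sqrtr1 oner_neq0.
  apply: cvg_sqrt; apply: cvgD; last exact: cvgMr.
  by apply: cvgD => //; exact: cvg_cst.
apply: squeeze_cvgr lo_lim up_lim.
near=> n.
have n_gt0 : (0 < n)%N by near: n; exact: nbhs_infty_gt.
(* This gives s >= 8, as [bin_mass_ge] requires. *)
have n64 : (64 <= n)%N by near: n; exact: nbhs_infty_ge.
set s := Num.sqrt n%:R.
have s_gt0 : 0 < s by rewrite sqrtr_gt0 ltr0n.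
have w_gt0 : 0 < window n by rewrite !sqrtr_gt0 invr_gt0 ltr0n.
have s8 : 8 <= s.
  rewrite -[8]ger0_norm // -sqrtr_sqr ler_wsqrtr //.
  by rewrite -natrX ler_nat.
have dn01 : 0 < d n < 1.
  rewrite sqrtr_gt0 w_gt0 /=; near: n.
  by apply: (cvgr_lt 0).
have sw : s = window n ^- 4 by rewrite window4 invrK.
have rE : Num.sqrt (pi * s) = Num.sqrt pi * window n ^- 2.
  rewrite sqrtrM ?pi_ge0 // sw; congr (_ * _).
  have -> : window n ^- 4 = (window n ^- 2) ^+ 2 by rewrite exprVn -exprM.
  by rewrite sqrtr_sqr ger0_norm // invr_ge0 exprn_ge0 // ltW.
have d2 : d n ^+ 2 = window n by rewrite sqr_sqrtr // ltW.
have S0 := sinh2_gt0 s_gt0.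
have ps0 : 0 < Num.sqrt (pi * s) by rewrite sqrtr_gt0 mulr_gt0 ?pi_gt0.
have d0' : 0 < d n by case/andP: dn01.
have d1' : 0 < 1 - d n by rewrite subr_gt0; case/andP: dn01.
have w_neq0 : window n != 0 by rewrite gt_eqF.
apply/andP; split.
  rewrite ler_pdivlMr //.
  apply: (@le_trans _ _ (Num.sqrt (pi * s) * (mass_lb n (d n) * (1 - 7 / (2 * s) / d n ^+ 2) * sinh2 s))).
    rewrite [X in _ <= X]mulrA; apply: ler_wpM2r; first exact: ltW.
    rewrite /lo /mass_lb -/s d2.
    rewrite (_ : 8 / s = 8 * window n ^+ 4); last by rewrite window4.
    rewrite (_ : (2 * s)^-1 = window n ^+ 4 / 2); last by rewrite window4 invfM mulrC.
    rewrite (_ : 3 * (window n ^+ 4 / 2) = 3 / 2 * window n ^+ 4); last by ring.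
    rewrite (_ : 7 * (window n ^+ 4 / 2) / window n = 7 / 2 * window n ^+ 3); last by field.
    rewrite mulrA (sqrtrM _ (ltW (mulr_gt0 (pi_gt0 R) s_gt0))).
    set c := Num.sqrt (1 + _ + _).
    have c0 : 0 < c.
      by rewrite sqrtr_gt0 !addr_gt0 // ?mulr_gt0 ?exprn_gt0.
    rewrite le_eqVlt; apply/orP; left; apply/eqP.
    move: (expR _) (Num.sqrt (pi * s)) ps0 => e r r0.
    by field; rewrite !gt_eqF.
  by rewrite ler_wpM2l ?(ltW ps0) // bin_mass_ge.
rewrite ler_pdivrMr //.
apply: (@le_trans _ _ (Num.sqrt (pi * s) * ((mass_ub n (d n) + 7 / (2 * s) / d n ^+ 2) * sinh2 s))).
  by rewrite ler_wpM2l ?(ltW ps0) // bin_mass_le.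
rewrite [X in X <= _]mulrA; apply: ler_wpM2r; first exact: ltW.
rewrite /up /mass_ub -/s d2 mulrDr lerD //.
  rewrite mulrA (sqrtrM _ (ltW (mulr_gt0 (pi_gt0 R) s_gt0))).
  have c0 : 0 < Num.sqrt (1 - d n) by rewrite sqrtr_gt0.
  rewrite le_eqVlt; apply/orP; left; apply/eqP.
  move: (expR _) (Num.sqrt (pi * s)) ps0 (Num.sqrt (1 - _)) c0 => e r r0 c c0.
  by field; rewrite !gt_eqF.
rewrite rE sw le_eqVlt; apply/orP; left; apply/eqP.
by move: (Num.sqrt pi) => p; field.
Unshelve. all: by end_near. Qed.

(** The quotient is 1 - exp(-4s), which lies between 1 - 1/s and 1. *)
Lemma cvg_sinh2_expR :
  2 * sinh2 (Num.sqrt n%:R) / expR (2 * Num.sqrt n%:R) @[n --> \oo] --> (1 : R).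
Proof.
have lim : (1 - window n ^+ 4 : R) @[n --> \oo] --> (1 : R).
  rewrite -[X in _ --> X]subr0; apply: cvgB; first exact: cvg_cst.
  rewrite -[X in _ --> X](expr0n R 4).
  apply: (continuous_cvg _ (@exprn_continuous R 4 0)); exact: cvg_window.
have lim1 : (fun _ : nat => 1 : R) @ \oo --> (1 : R) by exact: cvg_cst.
apply: squeeze_cvgr lim lim1.
near=> n.
have n_gt0 : (0 < n)%N by near: n; exact: nbhs_infty_gt.
rewrite window4; set s := Num.sqrt n%:R.
have s_gt0 : 0 < s by rewrite sqrtr_gt0 ltr0n.
have e0 := expR_gt0 (2 * s).
rewrite (_ : 2 * sinh2 s / expR (2 * s) = 1 - expR (- (2 * s)) ^+ 2); last first.
  by rewrite /sinh2 expRN; field; rewrite gt_eqF.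
rewrite gerBl sqr_ge0 andbT lerD2l lerN2 -expRM_natl mulrN expRN lef_pV2 ?posrE ?expR_gt0 //.
have := expR_ge1Dx (2 * (2 * s)); lra.
Unshelve. all: by end_near. Qed.

(** For large n, sqrt (n+1) <= n exp(-2), so (n+1)^(n/2) <= n^n exp(-2n) <= n! exp(-n), using n^n /
    n! <= exp n. Then n^4 / 4! <= exp n leaves at most 24/n. *)
Lemma cvg_nonfree_bound :
  (n ^ 3 * n.+1 ^ n./2)%:R / n`!%:R @[n --> \oo] --> (0 : R).
Proof.
have lim : 24 * n%:R^-1 @[n --> \oo] --> (0 : R).
  by rewrite -[X in _ --> X](mulr0 24); apply: cvgMr; exact: cvg_invn.
have lim0 : (fun _ : nat => 0 : R) @ \oo --> (0 : R) by exact: cvg_cst.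
apply: squeeze_cvgr lim0 lim.
near=> n.
have n_gt0 : (0 < n)%N by near: n; exact: nbhs_infty_gt.
have nR : 0 < n%:R :> R by rewrite ltr0n.
have fn0 k : 0 < k`!%:R :> R by rewrite ltr0n fact_gt0.
(* Ensures n + 1 <= 2n <= n^2 exp(-4). *)
have n_ge : 2 * expR 4 <= n%:R :> R by near: n; exact: nbhs_infty_ger.
rewrite divr_ge0 //=.
pose r : R := Num.sqrt n.+1%:R.
have r0 : 0 <= r by exact: sqrtr_ge0.
have r2 : r ^+ 2 = n.+1%:R by rewrite sqr_sqrtr.
have r1 : 1 <= r by rewrite -[1]sqrtr1 ler_wsqrtr // ler1n.
have rn : r <= n%:R * expR (- 2).
  rewrite expRN ler_pdivlMr ?expR_gt0 // -ler_sqr ?nnegrE ?mulr_ge0 ?expR_ge0 //.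
  rewrite exprMn r2 -expRM_natl (_ : 2 * 2 = 4); last by ring.
  apply: (@le_trans _ _ (n%:R * (2 * expR 4))); last by rewrite expr2 ler_pM2l.
  rewrite mulrA ler_pM2r ?expR_gt0 // -natr1.
  have n1 : 1 <= n%:R :> R by rewrite ler1n.
  by lra.
have pow : n.+1%:R ^+ n./2 <= n%:R ^+ n * expR (- (2 * n%:R)) :> R.
  rewrite -r2 -exprM; apply: (@le_trans _ _ (r ^+ n)).
    by rewrite ler_weXn2l // mul2n -{2}(odd_double_half n) leq_addl.
  apply: (@le_trans _ _ ((n%:R * expR (- 2)) ^+ n)); first by rewrite lerXn2r // nnegrE.
  by rewrite exprMn -expRM_natl mulrN mulrC [n%:R * 2]mulrC mulrC.
have nn : n%:R ^+ n / n`!%:R <= expR n%:R :> R.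
  have := @expR_ge1Dxn R n%:R n.-1 (ltW nR); rewrite prednK //.
  by apply: le_trans; rewrite lerDr.
have n4 : n%:R ^+ 4 / 24 <= expR n%:R :> R.
  have := @expR_ge1Dxn R n%:R 3 (ltW nR).
  rewrite (_ : 4`!%:R = 24 :> R); last by [].
  lra.
have pow_fact : n.+1%:R ^+ n./2 <= n`!%:R * expR (- n%:R) :> R.
  apply: le_trans pow _; rewrite ler_pdivrMr // mulrC in nn.
  rewrite (_ : - (2 * n%:R) = - n%:R - n%:R :> R); last by ring.
  rewrite expRD mulrA ler_wpM2r ?expR_ge0 //.
  by rewrite expRN ler_pdivrMr ?expR_gt0.
rewrite natrM !natrX ler_pdivrMr //.
apply: (@le_trans _ _ (n%:R ^+ 3 * (n`!%:R * expR (- n%:R)))).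
  by rewrite ler_wpM2l // exprn_ge0.
rewrite mulrCA [_ * n`!%:R]mulrC ler_wpM2l ?(ltW (fn0 _)) //.
rewrite expRN ler_pdivrMr ?expR_gt0 // mulrAC ler_pdivlMr // -exprSr.
by move: n4; rewrite ler_pdivrMr // mulrC.
Unshelve. all: by end_near. Qed.

End limits.

Lemma powR_seven_quarters (R : realType) (x : R) : 0 < x ->
  x `^ (7 / 4) = x * (Num.sqrt x * Num.sqrt (Num.sqrt x)).
Proof.
move=> x0; have xn0 : x != 0 by rewrite gt_eqF.
rewrite -!powR12_sqrt ?powR_ge0 ?ltW // -powRrM -powRD; last by rewrite xn0 implybT.
rewrite -{2}(powRr1 (ltW x0)) -powRD; last by rewrite xn0 implybT.
by congr (_ `^ _); lra.
Qed.

Theorem corollary4p3 (R : realType) :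
  (fun n : nat =>
     (V n)%:R /
     (n`!%:R * expR (2 * Num.sqrt n%:R) /
      (2 * Num.sqrt (pi * expR 1) * n%:R `^ (7 / 4))) : R) @ \oo --> (1 : R).
Proof.
(* [main] is the ratio of the theorem with V n replaced by the number of labeled crossings divided
   by n, factored into known limits; [err] absorbs the crossings with a nontrivial symmetry. *)
pose main n : R := Num.sqrt (pi * Num.sqrt n%:R) * bin_mass R n / sinh2 (Num.sqrt n%:R)
  * (2 * sinh2 (Num.sqrt n%:R) / expR (2 * Num.sqrt n%:R)) * Num.sqrt (expR 1).
pose err n : R := 2 * Num.sqrt (pi * expR 1) * ((n ^ 3 * n.+1 ^ n./2)%:R / n`!%:R).
have main_lim : main @ \oo --> (1 : R).
  rewrite [X in _ --> X](_ : _ = expR (- (1 / 2)) * 1 * Num.sqrt (expR 1)).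
    by apply: cvgMl; apply: cvgM; [exact: cvg_bin_mass|exact: cvg_sinh2_expR].
  have -> : expR 1 = expR (1 / 2) ^+ 2 :> R.
    by rewrite -expRM_natl; congr expR; lra.
  by rewrite sqrtr_sqr ger0_norm ?expR_ge0 // mulr1 -expRD addNr expR0.
have up_lim : (fun n => main n + err n) @ \oo --> (1 : R).
  rewrite [X in _ --> X](_ : _ = 1 + 2 * Num.sqrt (pi * expR 1) * 0).
    by apply: cvgD => //; apply: cvgMr; exact: cvg_nonfree_bound.
  by rewrite mulr0 addr0.
apply: squeeze_cvgr main_lim up_lim.
near=> n.
have n_gt0 : (0 < n)%N by near: n; exact: nbhs_infty_gt.
have nR : 0 < n%:R :> R by rewrite ltr0n.
have fn : 0 < n`!%:R :> R by rewrite ltr0n fact_gt0.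
have /andP[V_lb V_ub] := V_bounds n_gt0.
have L_mass := card_vcrossings_mass R n_gt0.
rewrite powR_seven_quarters // /main /err.
have s_gt0 : 0 < Num.sqrt n%:R :> R by rewrite sqrtr_gt0.
have s_ge1 : 1 <= Num.sqrt n%:R :> R by rewrite -[X in X <= _]sqrtr1 ler_wsqrtr // ler1n.
have s2 : Num.sqrt n%:R ^+ 2 = n%:R :> R by rewrite sqr_sqrtr.
have ss_gt0 : 0 < Num.sqrt (Num.sqrt n%:R) :> R by rewrite sqrtr_gt0.
have ss_ge1 : 1 <= Num.sqrt (Num.sqrt n%:R) :> R by rewrite -[X in X <= _]sqrtr1 ler_wsqrtr.
have ss2 : Num.sqrt (Num.sqrt n%:R) ^+ 2 = Num.sqrt n%:R :> R by rewrite sqr_sqrtr.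
have S0 := sinh2_gt0 s_gt0.
have e1 : 1 <= expR (2 * Num.sqrt n%:R) :> R.
  by apply: le_trans (expR_ge1Dx _); rewrite lerDl mulr_ge0.
have se0 : 0 < Num.sqrt (expR 1) :> R by rewrite sqrtr_gt0 expR_gt0.
have sp0 : 0 < Num.sqrt pi :> R by rewrite sqrtr_gt0 pi_gt0.
rewrite !(sqrtrM _ (pi_ge0 R)).
have Lv : #|vcrossings n|%:R <= (V n)%:R * n%:R :> R by rewrite -natrM ler_nat.
have Uv : (V n)%:R * n%:R <= #|vcrossings n|%:R + (n * (n * n.+1 ^ n./2))%:R :> R.
  rewrite -natrM -natrD ler_nat (leq_trans V_ub) // leq_add2l leq_mul2l.
  by rewrite card_nonfree orbT.
rewrite (_ : n ^ 3 * _ = n * (n * (n * n.+1 ^ n./2)))%N; last first.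
  by rewrite !expnS expn0 muln1 !mulnA.
rewrite [(n * (n * (n * _)))%:R]natrM.
have {L_mass}bmE : bin_mass R n = #|vcrossings n|%:R / n`!%:R * Num.sqrt n%:R.
  by rewrite L_mass mulrAC mulVf ?mul1r // gt_eqF.
rewrite {}bmE.
have q0 : 0 <= (n * (n * n.+1 ^ n./2))%:R :> R by [].
move: (V n)%:R (#|vcrossings n|)%:R (n * (n * _))%:R (n`!)%:R Lv Uv q0 fn => v l q f Lv Uv q0 f0.
have t_le_s : Num.sqrt (Num.sqrt n%:R) <= Num.sqrt n%:R :> R.
  by rewrite -[X in _ <= X]ss2 expr2 ler_peMl // ltW.
move: (n%:R) (Num.sqrt n%:R) (Num.sqrt (Num.sqrt n%:R)) (expR (2 * _)) (Num.sqrt (expR 1))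
  (Num.sqrt pi) (sinh2 _) nR s_gt0 s2 ss_gt0 t_le_s e1 se0 sp0 S0 Lv Uv.
move=> N s t E e p S N0 s0 s2 t0 ts E1 e0 p0 S0 Lv Uv.
have E0 : 0 < E by apply: lt_le_trans E1.
(* The ratio of the theorem is K times n * V n, and [main] is K times the number of labeled
   crossings. *)
set K := 2 * (p * e) * (s * t) / (f * E).
have K0 : 0 <= K.
  by rewrite divr_ge0 ?mulr_ge0 // ltW.
have Nn0 : N != 0 by rewrite gt_eqF.
have -> : v / (f * E / (2 * (p * e) * (N * (s * t)))) = K * (v * N).
  by rewrite /K; field; rewrite !gt_eqF.
have -> : p * t * (l / f * s) / S * (2 * S / E) * e = K * l.
  by rewrite /K; field; rewrite !gt_eqF.
rewrite ler_wpM2l //=; apply: le_trans (ler_wpM2l K0 Uv) _.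
rewrite mulrDr lerD2l (_ : _ * (N * q / f) = 2 * (p * e) * N / f * q); last by ring.
rewrite ler_wpM2r // /K ler_pdivrMr ?mulr_gt0 //.
rewrite [X in _ <= X](_ : _ = 2 * (p * e) * (N * E)); last by field; rewrite gt_eqF.
apply: ler_wpM2l; first by rewrite !mulr_ge0 // ltW.
(* The crude bounds t <= s and 1 <= E suffice; they cost the third factor n in [err]. *)
apply: (@le_trans _ _ (s * s)); first by rewrite ler_wpM2l // ltW.
by rewrite -expr2 s2 ler_peMr // ltW.
Unshelve. all: by end_near. Qed.
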